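(* Suppose that Slater's condition holds, i.e. there exists a policy $\tilde u$ such that $J_c(\tilde u)<\bar\rho$. Then the stationary policy $$u(x,\lambda^* )=-K(\lambda^* )x+l(\lambda^* )$$ is an optimal solution of the constrained problem of minimizing $J(u)$ over policies $u=\{u_0,u_1,\dots\}$ subject to the system dynamics and $J_c(u)\le\bar\rho$, where $$\lambda^*=\inf\{\lambda\ge0 : J_c(u(\cdot,\lambda))\le\bar\rho\}.$$
   Context: System: $x_{t+1}=Ax_t+Bu_t+w_t$, $t\ge 0$, with state $x_t\in\mathbb{R}^n$, control $u_t\in\mathbb{R}^m$, $A\in\mathbb{R}^{n\times n}$, $B\in\mathbb{R}^{n\times m}$ and initial state $x_0$. The $w_t\in\mathbb{R}^n$ are uncorrelated random noises with finite fourth-order moment, and the noise statistics below do not depend on $t$. A policy (control sequence) $u=\{u_0,u_1,\dots\}$ has the form $u_t=\pi_t(h_t)$, where $h_t=\{x_0,u_0,\dots,x_{t-1},u_{t-1},x_t\}$ is the history and $\pi_t$ is not necessarily deterministic. Expectations are over the noise and the policy. Standing assumptions: $Q\in\mathbb{R}^{n\times n}$ is positive semi-definite, $R\in\mathbb{R}^{m\times m}$ is positive definite, $(A,B)$ is stabilizable and $(A,Q^{1/2})$ is observable. Noise statistics: $\bar w=\mathbb{E}[w_t]$, $W=\mathbb{E}[(w_t-\bar w)(w_t-\bar w)^\top]$, $M_3=\mathbb{E}[(w_t-\bar w)(w_t-\bar w)^\top Q(w_t-\bar w)]$, $m_4=\mathbb{E}\big[\big((w_t-\bar w)^\top Q(w_t-\bar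 w)-\operatorname{tr}\{WQ\}\big)^2\big]$. Given the risk tolerance $\rho>0$, $\bar\rho=\rho-m_4+4\operatorname{tr}\{(WQ)^2\}$. Costs: $$J(u)=\limsup_{T\to\infty}\frac1T\mathbb{E}\sum_{t=0}^{T-1}(x_t^\top Qx_t+u_t^\top Ru_t),\qquad J_c(u)=\limsup_{T\to\infty}\frac1T\mathbb{E}\sum_{t=0}^{T-1}(4x_t^\top QWQx_t+4x_t^\top QM_3).$$ For $\lambda\ge0$ let $Q_\lambda=Q+4\lambda QWQ$ and $S=2QM_3$. Let $P$ be the positive semi-definite solution of $P=Q_\lambda+A^\top PA-A^\top PB(R+B^\top PB)^{-1}B^\top PA$, let $K(\lambda)=(R+B^\top PB)^{-1}B^\top PA$, let $g\in\mathbb{R}^n$ be the solution of $g^\top=(2\bar w^\top P+g^\top)(A-BK(\lambda))+2\lambda S^\top$, and let $l(\lambda)=-\tfrac12(R+B^\top PB)^{-1}B^\top(2P\bar w+g)$. Write $u(x,\lambda)=-K(\lambda)x+l(\lambda)$, and $u(\cdot,\lambda)$ for the stationary policy $u_t=u(x_t,\lambda)$, $t\ge0$.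
   Formalization: ''Uncorrelated'' noise is taken as: w_t is uncorrelated with every square-integrable function of past noises and the policy's randomization; Slater's policy must also have finite J. Without either the claim fails (predictable noise; unstable inversion with J infinite). *)

(* Defs.v *)
(* MathComp / MathComp-Analysis. *)
From HB Require Import structures.
From mathcomp Require Import all_boot all_order all_algebra.
From mathcomp Require Import all_classical all_reals all_analysis.
From mathcomp Require Import complex.

Set Implicit Arguments.
Unset Strict Implicit.
Unset Printing Implicit Defensive.

Import Order.TTheory GRing.Theory Num.Theory.
Import numFieldNormedType.Exports.

Local Open Scope classical_set_scope.
Local Open Scope ring_scope.

(* The Borel sigma-algebra of R^(m x n), as the one generated by the entries. *)
Section matrix_measurable.
Context {R : realType} (m n : nat).

Definition mx_entry_preimages : set (set 'M[R]_(m, n)) :=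
  [set X | exists i j, exists2 Y : set R,
     measurable Y & X = [set M : 'M[R]_(m, n) | Y (M i j)] ].

Definition mx_display : measure_display := sigma_display mx_entry_preimages.

Let mx_measurable0 : <<s mx_entry_preimages >> set0.
Proof. exact: sigma_algebra0. Qed.

Let mx_measurableC X :
  <<s mx_entry_preimages >> X -> <<s mx_entry_preimages >> (~` X).
Proof. exact: sigma_algebraC. Qed.

Let mx_measurable_bigcup (F : (set 'M[R]_(m, n))^nat) :
  (forall i, <<s mx_entry_preimages >> (F i)) ->
  <<s mx_entry_preimages >> (\bigcup_i F i).
Proof. exact: sigma_algebra_bigcup. Qed.

HB.instance Definition _ := @isMeasurable.Build mx_display 'M[R]_(m, n)
  <<s mx_entry_preimages >>
  mx_measurable0 mx_measurableC mx_measurable_bigcup.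

End matrix_measurable.

Section linear_systems.
Context {R : realType}.

Definition quad n (M : 'M[R]_n) (x : 'cV[R]_n) : R := (x^T *m M *m x) 0 0.

Definition psdmx n (M : 'M[R]_n) : Prop :=
  M^T = M /\ forall x : 'cV[R]_n, 0 <= quad M x.

Definition pdmx n (M : 'M[R]_n) : Prop :=
  M^T = M /\ forall x : 'cV[R]_n, x != 0 -> 0 < quad M x.

Definition schur_stable n (M : 'M[R]_n) : Prop :=
  forall z : R[i], eigenvalue (map_mx (real_complex R) M) z -> `|z| < 1.

Definition stabilizable n m (A : 'M[R]_n) (B : 'M[R]_(n, m)) : Prop :=
  exists K : 'M[R]_(m, n), schur_stable (A - B *m K).

Definition observable n p (A : 'M[R]_n) (C : 'M[R]_(p, n)) : Prop :=
  \rank (\mxcol_(k < n) (C *m A ^+ k)) = n.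

End linear_systems.

Section stochastic_control.
Context {R : realType} {d} {Omega : measurableType d} (Pr : probability Omega R).
Context {dS} {S : measurableType dS} {n m : nat}.
Implicit Types (w : nat -> Omega -> 'cV[R]_n) (u : nat -> Omega -> 'cV[R]_m).

Definition mx_expectation p q (X : Omega -> 'M[R]_(p, q)) : 'M[R]_(p, q) :=
  \matrix_(i, j) fine 'E_Pr[fun om => X om i j].

(* [xi t] is the random seed from which the control at time [t] is drawn.
   Every component of [w t] is uncorrelated with every square-integrable
   function of the earlier noises and of the seeds up to time [t], i.e. the
   conditional mean of [w t] given these variables is its mean.  Independent
   noises that are independent of the seeds satisfy this.  Pairwise
   uncorrelatedness of the [w t] alone would allow the noise to be a
   (nonlinear) function of the history. *)
Definition uncorrelated_noise w (xi : nat -> Omega -> S) : Prop :=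
  forall (t : nat) (f : t.-tuple 'cV[R]_n * t.+1.-tuple S -> R),
    measurable_fun setT f ->
    let X om := f ([tuple w s om | s < t], [tuple xi s om | s < t.+1]) in
    X \in Lfun Pr 2%:E ->
    forall i : 'I_n, covariance Pr (fun om => w t om i 0) X = 0%E.

Section plant.
Variables (A : 'M[R]_n) (B : 'M[R]_(n, m)) (x0 : 'cV[R]_n).

Fixpoint state w u (t : nat) (om : Omega) : 'cV[R]_n :=
  if t is s.+1 then A *m state w u s om + B *m u s om + w s om else x0.

(* u_t = pi_t(h_t, xi_t) with h_t = (x_0, ..., x_t; u_0, ..., u_(t-1)).
   With i.i.d. uniform seeds independent of the noise these are the controls
   u_t ~ pi_t(. | h_t) for stochastic kernels pi_t. *)
Definition is_policy w (xi : nat -> Omega -> S) u : Prop :=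
  forall t : nat,
  exists2 pi : (t.+1.-tuple 'cV[R]_n * t.-tuple 'cV[R]_m) * S -> 'cV[R]_m,
    measurable_fun setT pi &
    forall om, u t om =
      pi (([tuple state w u s om | s < t.+1], [tuple u s om | s < t]), xi t om).

Fixpoint feedback_state w (phi : 'cV[R]_n -> 'cV[R]_m) (t : nat) (om : Omega) :
    'cV[R]_n :=
  if t is s.+1 then
    A *m feedback_state w phi s om + B *m phi (feedback_state w phi s om)
      + w s om
  else x0.

Definition feedback w (phi : 'cV[R]_n -> 'cV[R]_m) :
    nat -> Omega -> 'cV[R]_m :=
  fun t om => phi (feedback_state w phi t om).

Lemma state_feedback w phi t om :
  state w (feedback w phi) t om = feedback_state w phi t om.
Proof. by elim: t => //= t ->. Qed.

Definition average_cost (c : 'cV[R]_n -> 'cV[R]_m -> R) w u : \bar R :=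
  limn_esup (fun T : nat => ((T%:R^-1)%:E *
    'E_Pr[(fun om => \sum_(t < T) c (state w u t om) (u t om))%R])%E).

End plant.

Definition constrained_optimal (U : Type) (admissible : U -> Prop)
    (J Jc : U -> \bar R) (rho : R) (u : U) : Prop :=
  [/\ admissible u, (Jc u <= rho%:E)%E &
      forall v, admissible v -> (Jc v <= rho%:E)%E -> (J u <= J v)%E].

End stochastic_control.

Section risk_constrained_lqr.
Context {R : realType} {n m : nat}.
Variables (A : 'M[R]_n) (B : 'M[R]_(n, m)) (Q : 'M[R]_n) (Ru : 'M[R]_m).
Variables (wbar : 'cV[R]_n) (W : 'M[R]_n) (M3 : 'cV[R]_n).

Definition lqr_stage_cost (x : 'cV[R]_n) (u : 'cV[R]_m) : R :=
  quad Q x + quad Ru u.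

(* M3 lies in the range of W, so this is bounded below and its expectation is
   well defined in the extended reals even when it is not integrable. *)
Definition risk_stage_cost (x : 'cV[R]_n) (u : 'cV[R]_m) : R :=
  4 * quad (Q *m W *m Q) x + 4 * (x^T *m Q *m M3) 0 0.

Definition Qlam (lam : R) : 'M[R]_n := Q + (4 * lam) *: (Q *m W *m Q).

Definition Svec : 'cV[R]_n := 2 *: (Q *m M3).

Definition lqr_gain (P : 'M[R]_n) : 'M[R]_(m, n) :=
  invmx (Ru + B^T *m P *m B) *m B^T *m P *m A.

Definition riccati (lam : R) (P : 'M[R]_n) : Prop :=
  P = Qlam lam + A^T *m P *m A
      - A^T *m P *m B *m invmx (Ru + B^T *m P *m B) *m B^T *m P *m A.

Definition linear_term (lam : R) (P : 'M[R]_n) (g : 'cV[R]_n) : Prop :=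
  g^T = (2 *: (wbar^T *m P) + g^T) *m (A - B *m lqr_gain P)
        + (2 * lam) *: Svec^T.

Definition lqr_offset (P : 'M[R]_n) (g : 'cV[R]_n) : 'cV[R]_m :=
  - (2^-1 *: (invmx (Ru + B^T *m P *m B) *m B^T *m (2 *: (P *m wbar) + g))).

Definition affine_law (P : 'M[R]_n) (g x : 'cV[R]_n) : 'cV[R]_m :=
  - (lqr_gain P *m x) + lqr_offset P g.

End risk_constrained_lqr.

(* Main.v *)
Require Import Defs.
From HB Require Import structures.
From mathcomp Require Import all_boot all_order all_algebra.
From mathcomp Require Import all_classical all_reals all_analysis.
From mathcomp Require Import measurable_realfun ring lra.

Set Implicit Arguments.
Unset Strict Implicit.
Unset Printing Implicit Defensive.

Import Order.TTheory GRing.Theory Num.Theory.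
Import numFieldNormedType.Exports.

Local Open Scope classical_set_scope.
Local Open Scope ring_scope.

(** The proof is Lagrangian duality for average costs.  For a multiplier [lam],
    the Lagrangian cost [lqr + lam * risk] is again a linear quadratic cost, and
    [quad P x + dot g x] solves its Bellman equation: completing the square
    ([completion_of_squares]) writes the Lagrangian cost of any square
    integrable policy as a constant [dual_value], plus a telescoping difference
    of values, plus the [regret], a nonnegative quadratic function of the
    deviation from the affine law ([bellman_sum]).  The noise contributes only
    its mean and covariance, since it is uncorrelated with the past
    ([Ex_quadlin_noise]).

    Weak duality ([dual_value_le]): the dual value is at most
    [J u + lam * Jc u] for every policy [u] of finite cost.  A finite cost makes
    all states and controls square integrable, and observability bounds the
    growth of the summed second moments of the state linearly, so the terminal
    value is negligible along a sequence of horizons.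

    Under the law for [lam] the costs converge.  The closed loop has a quadratic
    Lyapunov function by the Riccati equation and observability
    ([closed_loop_lyapunov]), and then the Lyapunov equation turns any quadratic
    running cost into a telescoping sum ([feedback_average]).  Call the limits
    [j lam] and [jc lam]; they satisfy [dual_value = j lam + lam * jc lam].

    The crucial point is that [jc] is continuous.  Nothing is known about the
    dependence of [P] and [g] on [lam], so the trajectories are compared
    instead: driven by the same noise, the trajectories for [lam] and [mu]
    differ in mean square by at most a multiple of the average regret of [mu]
    at [lam] ([coupling]), hence [jc mu] and [jc lam] differ by at most
    [eps + c * value_gap lam mu] for every [eps] ([risk_value_le_gap]).  As each
    law is optimal for its own multiplier, the gap is at most
    [(lam - mu) * (jc mu - jc lam)], and both estimates together give continuity
    ([risk_value_continuous]).

    Finally, let [v] be a Slater policy.  From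
    [j lam + lam * jc lam <= J v + lam * Jc v] and [0 <= j lam] large multipliers
    are feasible, so the infimum [lamstar] is taken over a nonempty set.  By
    continuity [jc lamstar <= rhobar], with equality when [0 < lamstar].  Hence
    [lamstar * jc lamstar = lamstar * rhobar], and weak duality at [lamstar]
    reads [j lamstar <= J u] for every feasible [u]. *)

(** * Bilinear and quadratic forms *)

Section forms.
Context {R : realType}.

Definition bil p q (M : 'M[R]_(p, q)) (x : 'cV[R]_p) (y : 'cV[R]_q) : R :=
  (x^T *m M *m y) 0 0.

Definition dot n (b x : 'cV[R]_n) : R := (b^T *m x) 0 0.

Definition sqnorm n (x : 'cV[R]_n) : R := dot x x.

Section bilinear.
Variables p q : nat.
Implicit Types (M : 'M[R]_(p, q)).

Lemma bilDl M x y z : bil M (x + y) z = bil M x z + bil M y z.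
Proof. by rewrite /bil linearD /= !mulmxDl mxE. Qed.

Lemma bilDr M x y z : bil M x (y + z) = bil M x y + bil M x z.
Proof. by rewrite /bil mulmxDr mxE. Qed.

Lemma bilNl M x y : bil M (- x) y = - bil M x y.
Proof. by rewrite /bil linearN /= !mulNmx mxE. Qed.

Lemma bilNr M x y : bil M x (- y) = - bil M x y.
Proof. by rewrite /bil mulmxN mxE. Qed.

Lemma bilZl M a x y : bil M (a *: x) y = a * bil M x y.
Proof. by rewrite /bil linearZ /= -!scalemxAl mxE. Qed.

Lemma bilZr M a x y : bil M x (a *: y) = a * bil M x y.
Proof. by rewrite /bil -!scalemxAr mxE. Qed.

Lemma bil0l M y : bil M 0 y = 0.
Proof. by rewrite /bil trmx0 !mul0mx mxE. Qed.

Lemma bilMD M N x y : bil (M + N) x y = bil M x y + bil N x y.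
Proof. by rewrite /bil mulmxDr mulmxDl mxE. Qed.

Lemma bilMN M x y : bil (- M) x y = - bil M x y.
Proof. by rewrite /bil mulmxN mulNmx mxE. Qed.

Lemma bilMZ a M x y : bil (a *: M) x y = a * bil M x y.
Proof. by rewrite /bil -scalemxAr -scalemxAl mxE. Qed.

Lemma bil_tr M x y : bil M x y = bil M^T y x.
Proof.
rewrite /bil; transitivity ((x^T *m M *m y)^T 0 0); first by rewrite [RHS]mxE.
by rewrite !trmx_mul trmxK mulmxA.
Qed.

Lemma bil_mull r (A : 'M[R]_(p, r)) M x y : bil M (A *m x) y = bil (A^T *m M) x y.
Proof. by rewrite /bil trmx_mul !mulmxA. Qed.

Lemma bil_mulr r (A : 'M[R]_(q, r)) M x y : bil M x (A *m y) = bil (M *m A) x y.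
Proof. by rewrite /bil !mulmxA. Qed.

Lemma bil_dot M x y : bil M x y = dot x (M *m y).
Proof. by rewrite /bil /dot mulmxA. Qed.

Lemma bilE M x y : bil M x y = \sum_i \sum_j M i j * (x i 0 * y j 0).
Proof.
rewrite bil_dot /dot mxE; apply: eq_bigr => i _.
rewrite !mxE mulr_sumr; apply: eq_bigr => j _; ring.
Qed.

End bilinear.

Lemma quad_bil n (M : 'M[R]_n) x : quad M x = bil M x x. Proof. by []. Qed.

Lemma dotC n (x y : 'cV[R]_n) : dot x y = dot y x.
Proof. by rewrite /dot !mxE; apply: eq_bigr => i _; rewrite !mxE mulrC. Qed.

Lemma dotE n (x y : 'cV[R]_n) : dot x y = \sum_i x i 0 * y i 0.
Proof. by rewrite /dot mxE; apply: eq_bigr => i _; rewrite mxE. Qed.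

Lemma dot_bil n (x y : 'cV[R]_n) : dot x y = bil 1%:M x y.
Proof. by rewrite bil_dot mul1mx. Qed.

Lemma dotDl n (x y z : 'cV[R]_n) : dot (x + y) z = dot x z + dot y z.
Proof. by rewrite !dot_bil bilDl. Qed.
Lemma dotDr n (x y z : 'cV[R]_n) : dot x (y + z) = dot x y + dot x z.
Proof. by rewrite !dot_bil bilDr. Qed.
Lemma dotNl n (x y : 'cV[R]_n) : dot (- x) y = - dot x y.
Proof. by rewrite !dot_bil bilNl. Qed.
Lemma dotNr n (x y : 'cV[R]_n) : dot x (- y) = - dot x y.
Proof. by rewrite !dot_bil bilNr. Qed.
Lemma dotZl n a (x y : 'cV[R]_n) : dot (a *: x) y = a * dot x y.
Proof. by rewrite !dot_bil bilZl. Qed.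
Lemma dotZr n a (x y : 'cV[R]_n) : dot x (a *: y) = a * dot x y.
Proof. by rewrite !dot_bil bilZr. Qed.

Lemma dot_mull n p (A : 'M[R]_(n, p)) x y : dot (A *m x) y = bil A^T x y.
Proof. by rewrite /dot trmx_mul. Qed.

Lemma dot_mulr n p (A : 'M[R]_(n, p)) x y : dot x (A *m y) = bil A x y.
Proof. by rewrite bil_dot. Qed.

Lemma dot_trmul n p (A : 'M[R]_(n, p)) x y : dot x (A^T *m y) = dot (A *m x) y.
Proof. by rewrite dot_mull dot_mulr. Qed.

Lemma quadD n (M : 'M[R]_n) x y : M^T = M ->
  quad M (x + y) = quad M x + 2 * bil M x y + quad M y.
Proof.
by move=> MT; rewrite !quad_bil bilDl !bilDr (bil_tr M y x) MT; ring.
Qed.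

Lemma quad_mul n p (M : 'M[R]_n) (A : 'M[R]_(n, p)) x :
  quad M (A *m x) = quad (A^T *m M *m A) x.
Proof. by rewrite !quad_bil bil_mull bil_mulr. Qed.

Lemma sqnorm_quad n (x : 'cV[R]_n) : sqnorm x = quad 1%:M x.
Proof. by rewrite /sqnorm dot_bil. Qed.

Lemma sqnormE n (x : 'cV[R]_n) : sqnorm x = \sum_i x i 0 ^+ 2.
Proof. by rewrite /sqnorm dotE; apply: eq_bigr => i _; rewrite expr2. Qed.

Lemma sqnorm_ge0 n (x : 'cV[R]_n) : 0 <= sqnorm x.
Proof. by rewrite sqnormE sumr_ge0 // => i _; rewrite sqr_ge0. Qed.

Lemma sqnorm0_eq0 n (x : 'cV[R]_n) : sqnorm x <= 0 -> x = 0.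
Proof.
move=> x0; have : sqnorm x == 0 by rewrite eq_le x0 sqnorm_ge0.
rewrite sqnormE psumr_eq0 => [/allP h|i _]; last exact: sqr_ge0.
apply/colP => i; rewrite mxE; apply/eqP.
by have := h i (mem_index_enum i); rewrite sqrf_eq0.
Qed.

Lemma sqr_entry_le n (x : 'cV[R]_n) i : x i 0 ^+ 2 <= sqnorm x.
Proof.
by rewrite sqnormE (bigD1 i) //= lerDl sumr_ge0 // => j _; rewrite sqr_ge0.
Qed.

Lemma sqnormD_le n (x y : 'cV[R]_n) :
  sqnorm (x + y) <= 2 * sqnorm x + 2 * sqnorm y.
Proof.
have := sqnorm_ge0 (x - y); rewrite /sqnorm !dotDl !dotDr !dotNl !dotNr.
rewrite (dotC y x); lra.
Qed.

Lemma sqnorm_sub_le n (x y : 'cV[R]_n) :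
  sqnorm (x - y) <= 2 * sqnorm x + 2 * sqnorm y.
Proof.
by have := sqnormD_le x (- y); rewrite {3}/sqnorm dotNl dotNr opprK.
Qed.

(** Young's inequality, from the squared norms of [e x + y] and [e x - y]. *)
Lemma dot_young n e (x y : 'cV[R]_n) : 0 < e ->
  `|dot x y| <= e * sqnorm x + e^-1 * sqnorm y.
Proof.
move=> e0.
have h1 := sqnorm_ge0 (e *: x + y); have h2 := sqnorm_ge0 (e *: x - y).
have hx : 0 <= e * (e * sqnorm x) by rewrite !mulr_ge0 ?sqnorm_ge0 // ltW.
have hy := sqnorm_ge0 y.
have exy : e * `|dot x y| <= e * (e * sqnorm x + e^-1 * sqnorm y).
  rewrite mulrDr (mulrA e e^-1) divff ?gt_eqF // mul1r.
  move: h1 h2 hx hy; rewrite /sqnorm !dotDl !dotDr !dotNl !dotNr !dotZl !dotZr.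
  rewrite (dotC y x) => h1 h2 hx hy.
  by case: ger0P => s; lra.
by rewrite ler_pM2l in exy.
Qed.

(** Evaluate the form at the multiple of [x - t y] that minimizes it in [t]. *)
Lemma pd_cauchy_schwarz n (M : 'M[R]_n) x y : pdmx M ->
  bil M x y ^+ 2 <= quad M x * quad M y.
Proof.
move=> [MT Mpd]; have [->|y0] := eqVneq y 0.
  by rewrite bil_tr !quad_bil !bil0l expr0n mulr0.
have q0 := Mpd _ y0.
have qpsd z : 0 <= quad M z.
  have [->|/Mpd/ltW//] := eqVneq z 0; by rewrite quad_bil bil0l.
have := qpsd (quad M y *: x - bil M x y *: y).
rewrite quadD // !quad_bil !(bilZl, bilZr, bilNl, bilNr).
rewrite -!quad_bil => h.
have : 0 <= quad M y * (quad M x * quad M y - bil M x y ^+ 2) by nra.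
by rewrite pmulr_rge0 // subr_ge0.
Qed.

Lemma sqnorm_pd n : pdmx (1%:M : 'M[R]_n).
Proof.
split=> [|x x0]; first exact: trmx1.
rewrite -sqnorm_quad lt_def sqnorm_ge0 andbT.
by apply: contraNneq x0 => h; apply/eqP/sqnorm0_eq0; rewrite h.
Qed.

Lemma sqnorm_mulmx_le p q (M : 'M[R]_(p, q)) :
  exists2 C, 0 <= C & forall y, sqnorm (M *m y) <= C * sqnorm y.
Proof.
exists (\sum_i sqnorm (row i M)^T); first by rewrite sumr_ge0 // => i _; exact: sqnorm_ge0.
move=> y; rewrite sqnormE mulr_suml ler_sum // => i _.
have -> : (M *m y) i 0 = bil 1%:M (row i M)^T y.
  by rewrite -dot_bil /dot trmxK -row_mul [RHS]mxE.
by rewrite !sqnorm_quad pd_cauchy_schwarz //; exact: sqnorm_pd.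
Qed.

Lemma bil_young p q (M : 'M[R]_(p, q)) e : 0 < e ->
  exists2 C, 0 <= C & forall x y, `|bil M x y| <= e * sqnorm x + C * sqnorm y.
Proof.
move=> e0; have [C C0 CM] := sqnorm_mulmx_le M.
exists (e^-1 * C); first by rewrite mulr_ge0 // invr_ge0 ltW.
move=> x y; rewrite bil_dot (le_trans (dot_young _ _ e0)) // lerD2l -mulrA.
by rewrite ler_wpM2l // invr_ge0 ltW.
Qed.

Lemma quad_le_sqnorm n (M : 'M[R]_n) :
  exists2 C, 0 <= C & forall x, `|quad M x| <= C * sqnorm x.
Proof.
have [C C0 CM] := bil_young M (@ltr01 R).
exists (1 + C); first by rewrite addr_ge0.
by move=> x; rewrite mulrDl quad_bil; exact: CM.
Qed.

Lemma pd_unitmx n (M : 'M[R]_n) : pdmx M -> M \in unitmx.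
Proof.
move=> [MT Mpd]; rewrite -row_free_unit -kermx_eq0; apply/eqP/row_matrixP => i.
rewrite row0; set v := row i _.
have vM : v *m M = 0 by rewrite /v -row_mul mulmx_ker row0.
apply/eqP; apply/negPn/negP => v0.
have vT0 : v^T != 0 by apply: contra v0 => /eqP h; rewrite -(trmxK v) h trmx0.
by have := Mpd _ vT0; rewrite /quad trmxK vM mul0mx mxE ltxx.
Qed.

(** The [i]-th coordinate of [x] is the [M]-product of [x] and [M^-1 e_i], so
    Cauchy-Schwarz gives coercivity without compactness. *)
Lemma pd_sqnorm_le n (M : 'M[R]_n) : pdmx M ->
  exists2 C, 0 <= C & forall x, sqnorm x <= C * quad M x.
Proof.
move=> Mpd; have Mu := pd_unitmx Mpd; have [MT Mp] := Mpd.
pose e (i : 'I_n) : 'cV[R]_n := invmx M *m delta_mx i 0.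
have q0 z : 0 <= quad M z.
  by have [->|/Mp/ltW//] := eqVneq z 0; rewrite quad_bil bil0l.
exists (\sum_i quad M (e i)); first by rewrite sumr_ge0.
move=> x; rewrite sqnormE mulr_suml ler_sum // => i _.
have -> : x i 0 = bil M x (e i).
  rewrite /e bil_dot mulmxA mulmxV // mul1mx dotE (bigD1 i) //= big1.
    by rewrite mxE !eqxx mulr1 addr0.
  by move=> j ji; rewrite mxE (negPf ji) mulr0.
by rewrite [leRHS]mulrC pd_cauchy_schwarz.
Qed.

End forms.

(** * Completion of squares for the Lagrangian *)

Section completion_of_squares.
Context {R : realType} {n m : nat}.
Variables (A : 'M[R]_n) (B : 'M[R]_(n, m)) (Q : 'M[R]_n) (Ru : 'M[R]_m).
Variables (wbar : 'cV[R]_n) (W : 'M[R]_n) (M3 : 'cV[R]_n).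

Definition quadlin (M : 'M[R]_n) (b x : 'cV[R]_n) : R := quad M x + dot b x.

(** The quadratic coefficient of the control in the Bellman equation with
    value function [quad P]. *)
Definition lqr_hessian (P : 'M[R]_n) : 'M[R]_m := Ru + B^T *m P *m B.

Definition closed_loop (P : 'M[R]_n) : 'M[R]_n := A - B *m lqr_gain A B Ru P.

Definition lagrangian_cost (lam : R) (x : 'cV[R]_n) (u : 'cV[R]_m) : R :=
  lqr_stage_cost Q Ru x u + lam * risk_stage_cost Q W M3 x u.

(** What completing the square leaves of the Bellman equation, apart from the
    contribution of the noise covariance. *)
Definition lqr_constant (P : 'M[R]_n) (g : 'cV[R]_n) : R :=
  quadlin P g wbar - quad (lqr_hessian P) (lqr_offset B Ru wbar P g).

Lemma quad0 p (M : 'M[R]_p) : quad M 0 = 0.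
Proof. by rewrite quad_bil bil0l. Qed.

Lemma lqr_hessian_pd P : pdmx Ru -> psdmx P -> pdmx (lqr_hessian P).
Proof.
move=> [RT Rp] [PT Pp]; split=> [|u u0].
  by rewrite /lqr_hessian linearD /= !trmx_mul trmxK RT PT mulmxA.
by rewrite quad_bil bilMD -!quad_bil -quad_mul ltr_wpDr // Rp.
Qed.

Section fixed_multiplier.
Variables (lam : R) (P : 'M[R]_n) (g : 'cV[R]_n).
Hypotheses (Rpd : pdmx Ru) (Ppsd : psdmx P).
Hypotheses (ricP : riccati A B Q Ru W lam P).
Hypothesis (ling : linear_term A B Q Ru wbar M3 lam P g).

Local Notation H := (lqr_hessian P).
Local Notation K := (lqr_gain A B Ru P).
Local Notation l := (lqr_offset B Ru wbar P g).

Let Hpd : pdmx H. Proof. exact: lqr_hessian_pd. Qed.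
Let Hu : H \in unitmx. Proof. exact: pd_unitmx. Qed.

Lemma hessian_gain (x : 'cV_n) : H *m (K *m x) = B^T *m (P *m (A *m x)).
Proof. by rewrite /lqr_gain -/(lqr_hessian P) !mulmxA mulmxV // mul1mx. Qed.

Lemma hessian_offset : H *m l = - (2^-1 *: (B^T *m (2 *: (P *m wbar) + g))).
Proof. by rewrite /lqr_offset -/(lqr_hessian P) mulmxN -scalemxAr !mulmxA mulmxV // mul1mx. Qed.

Lemma riccati_quad x :
  quad P x = quad (Qlam Q W lam) x + quad P (A *m x) - quad H (K *m x).
Proof.
have [PT _] := Ppsd; have [HT _] := Hpd.
rewrite [LHS](congr1 (fun M => quad M x) ricP) quad_bil bilMD bilMN bilMD.
rewrite -!quad_bil -quad_mul; congr (_ - _).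
set N := (X in quad X x = _); have -> : N =
    (B^T *m P *m A)^T *m invmx H *m (B^T *m P *m A).
  by rewrite /N !trmx_mul trmxK PT /lqr_hessian !mulmxA.
rewrite -quad_mul; have -> : B^T *m P *m A *m x = H *m (K *m x).
  by rewrite hessian_gain !mulmxA.
by rewrite quad_mul HT mulmxV // mul1mx.
Qed.

Lemma linear_term_dot x :
  dot g x = 2 * bil P wbar (closed_loop P *m x) + dot g (closed_loop P *m x)
            + 2 * lam * dot (Svec Q M3) x.
Proof.
have [PT _] := Ppsd.
have gE : g = (closed_loop P)^T *m (2 *: (P *m wbar) + g)
              + (2 * lam) *: Svec Q M3.
  rewrite -[LHS]trmxK ling linearD /= trmx_mul !(linearD, linearZ) /=.
  by rewrite trmx_mul !trmxK PT scalerA mulrC -scalerA.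
rewrite [LHS](congr1 (fun b => dot b x) gE) dotDl dotZl; congr (_ + _).
by rewrite dotC dot_trmul dotC dotDl dotZl bil_tr PT bil_dot dotC.
Qed.

(** The Riccati equation in closed-loop form: along [x_(t+1) = F x_t] the
    value [quad P] drops by exactly the stage cost. *)
Lemma riccati_stage x :
  quad P x - quad P (closed_loop P *m x) =
  quad (Qlam Q W lam) x + quad Ru (K *m x).
Proof.
have [PT _] := Ppsd.
have -> : closed_loop P *m x = A *m x - B *m (K *m x).
  by rewrite mulmxBl [in RHS]mulmxA.
rewrite riccati_quad quadD // bilNr.
have -> : quad P (- (B *m (K *m x))) = quad P (B *m (K *m x)).
  by rewrite !quad_bil bilNl bilNr opprK.
have e : quad H (K *m x) = bil P (A *m x) (B *m (K *m x)).
  by rewrite quad_bil bil_dot hessian_gain dot_trmul -bil_dot bil_tr PT.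
have : quad H (K *m x) = quad Ru (K *m x) + quad P (B *m (K *m x)).
  by rewrite quad_bil bilMD -!quad_bil -quad_mul.
by rewrite e; lra.
Qed.

(** The Riccati equation cancels the terms quadratic in [x] and the equation
    of [g] those linear in [x]; what depends on [u] is the squared deviation
    from the affine law. *)
Lemma completion_of_squares x u :
  quadlin P g (A *m x + B *m u + wbar) + lagrangian_cost lam x u =
  quadlin P g x + quad H (u - affine_law A B Ru wbar P g x)
  + lqr_constant P g.
Proof.
have [PT _] := Ppsd; have [HT _] := Hpd.
have Hq v : quad H v = quad Ru v + quad P (B *m v).
  by rewrite quad_bil bilMD -!quad_bil -quad_mul.
have Hk v : bil H v (K *m x) = bil P (A *m x) (B *m v).
  by rewrite bil_dot hessian_gain dot_trmul -bil_dot bil_tr PT.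
have Hl v : bil H v l = - bil P wbar (B *m v) - 2^-1 * dot g (B *m v).
  rewrite bil_dot hessian_offset dotNr dotZr dot_trmul dotDr dotZr -bil_dot.
  by rewrite bil_tr PT (dotC _ g); field.
have -> : u - affine_law A B Ru wbar P g x = u + K *m x - l.
  by rewrite /affine_law opprD opprK addrA.
have Psym y z : bil P y z = bil P z y by rewrite bil_tr PT.
have qN v : quad H (- v) = quad H v by rewrite !quad_bil bilNl bilNr opprK.
have FE : closed_loop P *m x = A *m x - B *m (K *m x).
  by rewrite mulmxBl [in RHS]mulmxA.
have ric := riccati_quad x.
have lin := linear_term_dot x.
have ck : lam * (4 * (x^T *m Q *m M3) 0 0) = 2 * lam * dot (Svec Q M3) x.
  by rewrite /Svec dotZl dotC -bil_dot /bil; ring.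
have cq : quad Q x + lam * (4 * quad (Q *m W *m Q) x) = quad (Qlam Q W lam) x.
  by rewrite /Qlam [RHS]quad_bil bilMD bilMZ -!quad_bil; ring.
rewrite FE bilDr dotDr bilNr dotNr in lin.
rewrite /quadlin /lqr_constant /quadlin /lagrangian_cost /lqr_stage_cost.
rewrite /risk_stage_cost mulrDr ck.
move: l Hl (K *m x) Hk FE ric lin => L Hl k Hk FE ric lin.
rewrite !(quadD _ _ PT) !(quadD _ _ HT) !dotDr !bilDl !bilNr !qN.
rewrite !Hl !Hk Hq (Psym _ wbar) (Psym (B *m u) wbar).
lra.
Qed.

End fixed_multiplier.

End completion_of_squares.

(** * Observability and Lyapunov functions *)

Section observability.
Context {R : realType} {n : nat}.
Variables (A : 'M[R]_n) (C : 'M[R]_n).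

Lemma observable_left_inverse : observable A C ->
  exists L : 'I_n -> 'M[R]_n, \sum_k L k *m (C *m A ^+ k) = 1%:M.
Proof.
move=> obs; have /row_fullP[D] : row_full (\mxcol_(k < n) (C *m A ^+ k)).
  by rewrite /row_full obs.
rewrite -(submxrowK D) mul_mxrow_mxcol => e.
by exists (submxrow D).
Qed.

Lemma sqnorm_sum_le k p (x : 'I_k -> 'cV[R]_p) :
  sqnorm (\sum_i x i) <= 2 ^+ k * \sum_i sqnorm (x i).
Proof.
elim: k x => [|k IH] x; first by rewrite !big_ord0 mulr0 sqnorm_quad quad0.
rewrite !big_ord_recr /= (le_trans (sqnormD_le _ _)) // mulrDr lerD //.
  by rewrite exprS -mulrA ler_wpM2l.
by rewrite ler_wpM2r ?sqnorm_ge0 // exprS ler_peMr // exprn_ege1 // ler1n.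
Qed.

(** By induction on [k]: [M A^(k+1) x_0] is [M A^k x_1] up to [M A^k v_0]. *)
Lemma observed_power k p (M : 'M[R]_(p, n)) : exists2 c, 0 <= c &
  forall x v : nat -> 'cV[R]_n, (forall t, x t.+1 = A *m x t + v t) ->
  sqnorm (M *m A ^+ k *m x 0%N) <=
    c * (sqnorm (M *m x k) + \sum_(i < k) sqnorm (v i)).
Proof.
elim: k => [|k [c c0 IH]].
  by exists 1 => // x v _; rewrite big_ord0 addr0 mul1r expr0 mulmx1.
have [c' c'0 Mc'] := sqnorm_mulmx_le (M *m A ^+ k).
exists (2 * c + 2 * c'); first by rewrite addr_ge0 ?mulr_ge0.
move=> x v xv; have := IH (fun t => x t.+1) (fun t => v t.+1) (fun t => xv t.+1).
rewrite big_ord_recl; set s := \sum_(i < k) _;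
have s0 : 0 <= s by apply: sumr_ge0 => i _; exact: sqnorm_ge0.
have -> : M *m A ^+ k.+1 *m x 0%N = M *m A ^+ k *m x 1%N - M *m A ^+ k *m v 0%N.
  by rewrite xv mulmxDr addrK exprSr !mulmxA.
have := Mc' (v 0%N); have := sqnorm_sub_le (M *m A ^+ k *m x 1%N) (M *m A ^+ k *m v 0%N).
have := sqnorm_ge0 (M *m x k.+1); have := sqnorm_ge0 (v 0%N).
set a := sqnorm (v _); set b := sqnorm (M *m x _).
move=> a0 b0 h1 h2 h3; apply: (le_trans h1).
have h4 : 0 <= c * a by rewrite mulr_ge0.
have h5 : 0 <= c' * (b + s) by rewrite mulr_ge0 // addr_ge0.
rewrite /=; lra.
Qed.

(** The initial state of [x_(t+1) = A x_t + v_t] is a linear function of the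
    outputs [C x_t] and the inputs [v_t] over [n] steps. *)
Lemma observable_sqnorm_le : observable A C -> exists2 c, 0 <= c &
  forall x v : nat -> 'cV[R]_n, (forall t, x t.+1 = A *m x t + v t) ->
  sqnorm (x 0%N) <= c * \sum_(i < n) (sqnorm (C *m x i) + sqnorm (v i)).
Proof.
move=> /observable_left_inverse[L LE].
have /choice[c cP] : forall k : 'I_n, exists c, 0 <= c /\
    forall x v : nat -> 'cV[R]_n, (forall t, x t.+1 = A *m x t + v t) ->
    sqnorm (L k *m (C *m A ^+ k) *m x 0%N) <=
    c * \sum_(i < n) (sqnorm (C *m x i) + sqnorm (v i)).
  move=> k; have [c1 c10 Lc] := sqnorm_mulmx_le (L k).
  have [c2 c20 Oc] := observed_power k C.
  exists (c1 * c2); split=> [|x v xv]; first exact: mulr_ge0.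
  rewrite -mulmxA (le_trans (Lc _)) // -mulrA ler_wpM2l //.
  rewrite (le_trans (Oc _ _ xv)) // ler_wpM2l // big_split /= lerD //.
    by rewrite (bigD1 k) //= lerDl sumr_ge0 // => i _; exact: sqnorm_ge0.
  rewrite (big_ord_widen n (fun i => sqnorm (v i))) 1?ltnW //.
  rewrite [leRHS](bigID (fun i : 'I_n => (i < k)%N)) /= lerDl.
  by rewrite sumr_ge0 // => i _; exact: sqnorm_ge0.
exists (2 ^+ n * \sum_k c k).
  by rewrite mulr_ge0 ?exprn_ge0 // sumr_ge0 // => k _; case: (cP k).
move=> x v xv; rewrite -[x 0%N]mul1mx -LE mulmx_suml.
rewrite (le_trans (sqnorm_sum_le _)) // -mulrA ler_wpM2l ?exprn_ge0 //.
rewrite mulr_suml ler_sum // => k _; exact: (cP k).2.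
Qed.

End observability.

Section lyapunov.
Context {R : realType} {n : nat}.
Implicit Types (F X : 'M[R]_n).

(** A quadratic Lyapunov function certifying that [x_(t+1) = F x_t + v_t] is
    input-to-state stable in mean square. *)
Definition lyapunov F X r C : Prop :=
  [/\ X^T = X, 0 <= r < 1, 0 <= C, forall x, sqnorm x <= C * quad X x &
      forall x v, quad X (F *m x + v) <= r * quad X x + C * sqnorm v].

(** The cross term of [quad X (F x + v)] costs half of the decrease by Young's
    inequality; the other half is a fixed fraction of [quad X x] because
    [quad X] is bounded by the squared norm. *)
Lemma lyapunov_of_decrease F X C : psdmx X -> 0 < C ->
  (forall x, sqnorm x <= C * (quad X x - quad X (F *m x))) ->
  exists r C', lyapunov F X r C'.
Proof.
move=> [XT Xp] C0 dec.
have [D D0 DX] := quad_le_sqnorm X.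
pose D1 := D + 1; have D10 : 0 < D1 by rewrite ltr_wpDl.
have DX1 x : quad X x <= D1 * sqnorm x.
  rewrite (le_trans (ler_norm _)) // (le_trans (DX x)) //.
  by rewrite ler_wpM2r ?sqnorm_ge0 // lerDl.
(* the cross term occurs twice, and each copy may use a quarter of the decrease *)
have e0 : 0 < (4 * C)^-1 by rewrite invr_gt0 mulr_gt0.
have [E E0 EX] := bil_young (F^T *m X) e0.
pose k := (2 * C * D1)^-1.
have k0 : 0 < k by rewrite invr_gt0 !mulr_gt0.
have CXx x : sqnorm x <= C * quad X x.
  by rewrite (le_trans (dec x)) // ler_pM2l // gerBl Xp.
exists (Num.max 0 (1 - k)), (C + 2 * E + D1); split => //.
- by rewrite le_max lexx /= gt_max ltr01 /= ltrBlDr ltrDl.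
- by rewrite !addr_ge0 ?mulr_ge0 // ltW.
- move=> x; rewrite (le_trans (CXx x)) // ler_wpM2r //.
  by rewrite -addrA lerDl addr_ge0 ?mulr_ge0 // ltW.
move=> x v.
have rq : (1 - k) * quad X x <= Num.max 0 (1 - k) * quad X x.
  by rewrite ler_wpM2r // le_max lexx orbT.
apply: (@le_trans _ _ ((1 - k) * quad X x + (2 * E + D1) * sqnorm v)); last first.
  by rewrite lerD // ler_wpM2r ?sqnorm_ge0 // -addrA lerDr ltW.
rewrite quadD // bil_mull.
have h1 : 2 * bil (F^T *m X) x v <= (2 * C)^-1 * sqnorm x + 2 * E * sqnorm v.
  have := le_trans (ler_norm _) (EX x v).
  have -> : (2 * C)^-1 = 2 * (4 * C)^-1 by field; rewrite gt_eqF.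
  lra.
have h2 : C^-1 * sqnorm x <= quad X x - quad X (F *m x).
  by rewrite ler_pdivrMl.
have h3 : k * quad X x <= (2 * C)^-1 * sqnorm x.
  rewrite /k invfM -mulrA ler_pM2l ?invr_gt0 ?mulr_gt0 //.
  by rewrite ler_pdivrMl.
have h4 : C^-1 = (2 * C)^-1 + (2 * C)^-1 by field; rewrite gt_eqF.
have := DX1 v; rewrite h4 in h2; lra.
Qed.

Variables (F X : 'M[R]_n) (r C : R).
Hypothesis lyap : lyapunov F X r C.

Lemma lyapunov_ge0 x : 0 <= quad X x.
Proof.
have [_ _ C0 h _] := lyap; have := le_trans (sqnorm_ge0 x) (h x).
have [C00|Cn0] := eqVneq C 0; last by rewrite pmulr_rge0 // lt_def Cn0.
have -> : x = 0 by apply: sqnorm0_eq0; rewrite (le_trans (h x)) // C00 mul0r.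
by rewrite quad0.
Qed.

Lemma lyapunov_pow k x : quad X (F ^+ k *m x) <= r ^+ k * quad X x.
Proof.
have [XT /andP[r0 r1] C0 h dec] := lyap.
elim: k => [|k IH]; first by rewrite !expr0 mul1mx mul1r.
rewrite !exprS -mulmxA -[_ *m _]addr0 (le_trans (dec _ _)) //.
rewrite sqnorm_quad quad0 mulr0 addr0 -mulrA ler_wpM2l //.
Qed.

(** The recursion [quad X e_(t+1) <= r quad X e_t + C |v_t|^2] summed over [t]:
    the energy of the response is at most a multiple of that of the input. *)
Lemma lyapunov_sum (e v : nat -> 'cV[R]_n) T : e 0%N = 0 ->
  (forall t, e t.+1 = F *m e t + v t) ->
  \sum_(t < T) sqnorm (e t) <= C * C / (1 - r) * \sum_(t < T) sqnorm (v t).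
Proof.
move=> e0 ev; have [XT /andP[r0 r1] C0 h dec] := lyap.
have r1' : 0 < 1 - r by rewrite subr_gt0.
have : quad X (e T) + (1 - r) * \sum_(t < T) quad X (e t) <=
    C * \sum_(t < T) sqnorm (v t).
  elim: T => [|T IH]; first by rewrite !big_ord0 e0 quad0 !mulr0 addr0.
  rewrite !big_ord_recr /= ev; have := dec (e T) (v T); lra.
have := lyapunov_ge0 (e T) => q0 hs.
have {q0}hs : \sum_(t < T) quad X (e t) <= C / (1 - r) * \sum_(t < T) sqnorm (v t).
  rewrite mulrAC ler_pdivlMr //; lra.
rewrite (@le_trans _ _ (C * \sum_(t < T) quad X (e t))) //.
  by rewrite mulr_sumr ler_sum.
by rewrite -!mulrA ler_wpM2l // mulrA.
Qed.

Lemma lyapunov_geometric_le0 a K : (forall k, a <= r ^+ k * K) -> a <= 0.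
Proof.
have [_ /andP[r0 r1] _ _ _] := lyap => h.
have cv : (fun k => r ^+ k * K) @ \oo --> (0 : R).
  rewrite -[X in _ --> X](mul0r K); apply: cvgMl; apply: cvg_expr.
  by rewrite ger0_norm.
by apply: (cvgr_to_ge cv); apply: nearW => k; exact: h.
Qed.

(** A solution of the homogeneous Lyapunov equation equals its [k]-th iterate
    [(F^k)^T Y F^k], which tends to [0]. *)
Lemma lyapunov_fixed0 (Y : 'M[R]_n) : Y = F^T *m Y *m F -> Y = 0.
Proof.
move=> YE; have [_ _ C0 h _] := lyap.
have Ystep x y : bil Y x y = bil Y (F *m x) (F *m y).
  by rewrite [in LHS]YE -bil_mulr -bil_mull.
have YFk k x y : bil Y x y = bil Y (F ^+ k *m x) (F ^+ k *m y).
  elim: k => [|k ->]; first by rewrite expr0 !mul1mx.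
  by rewrite [LHS]Ystep exprS -!mulmxA.
have [D D0 YD] := bil_young Y (@ltr01 R).
have Fk k x : sqnorm (F ^+ k *m x) <= r ^+ k * (C * quad X x).
  by rewrite (le_trans (h _)) // mulrCA ler_wpM2l // lyapunov_pow.
have bil0 x y : bil Y x y = 0.
  apply/eqP; rewrite -normr_le0.
  apply: (@lyapunov_geometric_le0 _ (C * quad X x + D * (C * quad X y))) => k.
  rewrite (YFk k) (le_trans (YD _ _)) // mul1r mulrDr lerD //.
  by rewrite mulrCA ler_wpM2l.
apply/matrixP => i j; rewrite mxE -(bil0 (delta_mx i 0) (delta_mx j 0)).
by rewrite /bil trmx_delta -rowE -colE !mxE.
Qed.

Lemma injective_linear_surjective (U : vectType R) (f : {linear U -> U}) :
  (forall x, f x = 0 -> x = 0) -> forall y, exists x, f x = y.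
Proof.
move=> inj y; have k0 : lker (linfun f) == 0%VS.
  apply/lker0P => a b; rewrite !lfunE /= => ab.
  by apply/eqP; rewrite -subr_eq0; apply/eqP/inj; rewrite linearB /= ab subrr.
by exists ((linfun f)^-1%VF y); rewrite -[f _]lfunE /= lker0_lfunVK.
Qed.

(** The operator [Y |-> Y - F^T Y F] is injective, hence onto in finite
    dimension. *)
Lemma lyapunov_equation (M : 'M[R]_n) : exists Y, Y = F^T *m Y *m F + M.
Proof.
pose f (Y : 'M[R]_n) := Y - F^T *m Y *m F.
have lf : linear f.
  move=> a Y Z; rewrite /f mulmxDr mulmxDl -scalemxAr -scalemxAl.
  by rewrite opprD addrACA scalerBr.
pose fl := GRing.isLinear.Build _ _ _ _ f lf.
pose fL : {linear _ -> _} := HB.pack f fl.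
have [Y YM] := @injective_linear_surjective _ fL
  (fun Y (e : f Y = 0) => lyapunov_fixed0 (subr0_eq e)) M.
by exists Y; apply/eqP; rewrite addrC -subr_eq; apply/eqP.
Qed.

Lemma lyapunov_affine_equation (b : 'cV[R]_n) : exists h, h = F^T *m h + b.
Proof.
have [_ _ C0 XC _] := lyap.
pose f (h : 'cV[R]_n) := h - F^T *m h.
have lf : linear f.
  by move=> a h k; rewrite /f mulmxDr -scalemxAr opprD addrACA scalerBr.
pose fl := GRing.isLinear.Build _ _ _ _ f lf.
pose fL : {linear _ -> _} := HB.pack f fl.
have inj h : f h = 0 -> h = 0.
  move=> /subr0_eq hE.
  have hk k x : dot h x = dot h (F ^+ k *m x).
    elim: k => [|k ->]; first by rewrite expr0 mul1mx.
    by rewrite [in LHS]hE dotC dot_trmul dotC exprS -mulmxA.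
  apply: sqnorm0_eq0; set s := sqnorm h.
  suff ss : s ^+ 2 <= 0.
    by rewrite leNgt; apply/negP => s0; have := exprn_gt0 2 s0; rewrite ltNge ss.
  apply: (@lyapunov_geometric_le0 _ (s * (C * quad X h))) => k.
  rewrite {1}/s /sqnorm (hk k) dot_bil (le_trans (pd_cauchy_schwarz _ _ (sqnorm_pd n))) //.
  rewrite -!sqnorm_quad mulrCA ler_wpM2l ?sqnorm_ge0 //.
  by rewrite (le_trans (XC _)) // mulrCA ler_wpM2l // lyapunov_pow.
have [h hb] := @injective_linear_surjective _ fL inj b.
by exists h; apply/eqP; rewrite addrC -subr_eq; apply/eqP.
Qed.

End lyapunov.

(** * Stability of the optimal closed loop *)

Section closed_loop_stability.
Context {R : realType} {n m : nat}.
Variables (A : 'M[R]_n) (B : 'M[R]_(n, m)) (Q Qhalf : 'M[R]_n) (Ru : 'M[R]_m).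
Variables (W : 'M[R]_n).
Hypotheses (Qpsd : psdmx Q) (Rpd : pdmx Ru).
Hypotheses (Qhalf_psd : psdmx Qhalf) (QhalfE : Qhalf *m Qhalf = Q).
Hypotheses (AQobs : observable A Qhalf).
Hypothesis Wpsd : forall x, 0 <= quad W x.

Lemma quad_QhalfE x : quad Q x = sqnorm (Qhalf *m x).
Proof.
by have [QT _] := Qhalf_psd; rewrite sqnorm_quad quad_mul QT mulmx1 QhalfE.
Qed.

Lemma quad_QWQ_ge0 x : 0 <= quad (Q *m W *m Q) x.
Proof.
have [QT _] := Qpsd.
by have := Wpsd (Q *m x); rewrite quad_mul QT.
Qed.

Lemma quad_Qlam_ge lam x : 0 <= lam -> quad Q x <= quad (Qlam Q W lam) x.
Proof.
move=> lam0; rewrite /Qlam [leRHS]quad_bil bilMD bilMZ -!quad_bil lerDl.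
by rewrite !mulr_ge0 // quad_QWQ_ge0.
Qed.

(** [Q]-costs are squared norms of the outputs [Qhalf x], to which observability
    applies. *)
Lemma observed_state : exists2 c, 0 <= c &
  forall x v : nat -> 'cV[R]_n, (forall t, x t.+1 = A *m x t + v t) ->
  forall t,
  sqnorm (x t) <= c * \sum_(i < n) (quad Q (x (t + i)%N) + sqnorm (v (t + i)%N)).
Proof.
have [c c0 obs] := observable_sqnorm_le AQobs; exists c => // x v xv t.
have := obs (fun i => x (t + i)%N) (fun i => v (t + i)%N).
rewrite addn0 => h.
rewrite (le_trans (h _)) => [//|i|]; first by rewrite addnS xv.
by rewrite ler_wpM2l // ler_sum // => i _; rewrite quad_QhalfE.
Qed.

(** Along the closed loop [quad P] drops by at least [quad Q x + quad Ru (K x)].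
    Observability lets [n] consecutive drops dominate the squared norm of the
    state, so the sum of [quad P] over [n] consecutive states, which is again a
    quadratic form [quad X] of the first one, decreases strictly. *)
Lemma closed_loop_lyapunov lam P : 0 <= lam -> psdmx P ->
  riccati A B Q Ru W lam P ->
  exists X r C, lyapunov (closed_loop A B Ru P) X r C.
Proof.
move=> lam0 Ppsd ricP; set F := closed_loop A B Ru P; set K := lqr_gain A B Ru P.
have [PT P0] := Ppsd; have [_ Rp] := Rpd.
have R0 u : 0 <= quad Ru u.
  by have [->|/Rp/ltW//] := eqVneq u 0; rewrite quad0.
have Q0 x : 0 <= quad Q x by case: Qpsd.
have [c c0 obs] := observed_state.
have [b b0 Bb] := sqnorm_mulmx_le B.
have [rr rr0 Rr] := pd_sqnorm_le Rpd.
pose X := \sum_(i < n) (F ^+ i)^T *m P *m F ^+ i.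
have XE x : quad X x = \sum_(i < n) quad P (F ^+ i *m x).
  rewrite /X; elim/big_ind2: _ => [|M a N a' <- <-|i _].
  - by rewrite quad_bil bil_dot mul0mx dotE big1 // => i _; rewrite mxE mulr0.
  - by rewrite !quad_bil bilMD.
  - by rewrite quad_mul.
have stage x : quad Q x + quad Ru (K *m x) <= quad P x - quad P (F *m x).
  by rewrite (riccati_stage Rpd Ppsd ricP) lerD2r quad_Qlam_ge.
have decE x : quad X x - quad X (F *m x) =
    \sum_(i < n) (quad P (F ^+ i *m x) - quad P (F *m (F ^+ i *m x))).
  rewrite !XE -sumrB; apply: eq_bigr => i _; congr (_ - quad P _).
  by rewrite !mulmxA -[F ^+ i *m F]exprSr -[F *m F ^+ i]exprS.
pose k := c * (1 + b * rr) + 1.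
exists X; apply: (@lyapunov_of_decrease _ _ F X k); last first.
- move=> x; rewrite decE.
  have := obs (fun i => F ^+ i *m x) (fun i => - (B *m (K *m (F ^+ i *m x)))).
  move/(_ _ 0%N); rewrite expr0 mul1mx => h.
  rewrite (le_trans (h _)) => [//|t|].
    rewrite exprS -mulmxA /F /closed_loop mulmxBl; congr (_ - _).
    by rewrite -/F -/K -!mulmxA.
  rewrite /k mulrDl mul1r ler_wpDr //.
    rewrite sumr_ge0 // => i _; rewrite (le_trans _ (stage _)) //.
    by rewrite addr_ge0.
  rewrite -mulrA ler_wpM2l // mulr_sumr ler_sum // => i _.
  set y := F ^+ _ *m x; have := stage y => hs.
  have -> : sqnorm (- (B *m (K *m y))) = sqnorm (B *m (K *m y)).
    by rewrite /sqnorm dotNl dotNr opprK.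
  have h1 : sqnorm (B *m (K *m y)) <= b * rr * quad Ru (K *m y).
    by rewrite (le_trans (Bb _)) // -mulrA ler_wpM2l.
  have h2 : (1 + b * rr) * (quad Q y + quad Ru (K *m y)) <=
      (1 + b * rr) * (quad P y - quad P (F *m y)).
    by rewrite ler_wpM2l // addr_ge0 // mulr_ge0.
  have h3 : 0 <= b * rr * quad Q y by rewrite !mulr_ge0.
  have := R0 (K *m y); lra.
- by rewrite /k ltr_wpDl // mulr_ge0 // addr_ge0 // mulr_ge0.
split=> [|x]; last by rewrite XE sumr_ge0.
rewrite /X linear_sum; apply: eq_bigr => i _ /=.
by rewrite !trmx_mul trmxK PT mulmxA.
Qed.

End closed_loop_stability.

Section quadlin_bounds.
Context {R : realType} {n : nat}.
Variables (M : 'M[R]_n) (b : 'cV[R]_n).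

Lemma quadlin_le : exists2 C, 0 <= C &
  forall x, `|quadlin M b x| <= C * (1 + sqnorm x).
Proof.
have [C C0 CM] := quad_le_sqnorm M; exists (C + sqnorm b + 1).
  by rewrite !addr_ge0 ?sqnorm_ge0.
move=> x; have := ler_normD (quad M x) (dot b x); have := CM x.
have := dot_young b x (@ltr01 R); rewrite invr1 !mul1r /quadlin.
have := sqnorm_ge0 x; have := sqnorm_ge0 b.
have := mulr_ge0 C0 (sqnorm_ge0 x); have := mulr_ge0 (sqnorm_ge0 b) (sqnorm_ge0 x).
lra.
Qed.

Lemma quadlin_perturb eps : 0 < eps -> exists2 C, 0 <= C & forall x e,
  `|quadlin M b (x + e) - quadlin M b x| <= eps * (1 + sqnorm x) + C * sqnorm e.
Proof.
move=> eps0; have [C C0 CM] := quad_le_sqnorm M.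
have [D D0 DM] := bil_young (M + M^T) eps0.
have b1 : 0 < sqnorm b + 1 by rewrite ltr_wpDl ?sqnorm_ge0.
pose eta := eps / (sqnorm b + 1); have eta0 : 0 < eta by exact: divr_gt0.
exists (C + D + eta^-1); first by rewrite !addr_ge0 // invr_ge0 ltW.
move=> x e.
have -> : quadlin M b (x + e) - quadlin M b x =
    bil (M + M^T) x e + quad M e + dot b e.
  rewrite /quadlin !quad_bil bilMD -bil_tr bilDl !bilDr dotDr; ring.
rewrite (le_trans (ler_normD _ _)) //.
have := ler_normD (bil (M + M^T) x e) (quad M e).
have := DM x e; have := CM e; have := dot_young b e eta0.
have : eta * sqnorm b <= eps.
  rewrite /eta mulrAC ler_pdivrMr // ler_wpM2l ?lerDl ?ler01 // ltW //.
lra.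
Qed.

End quadlin_bounds.

(** * Expectation on L1 and L2 *)

Section expectation.
Context {R : realType} {d} {Omega : measurableType d} (Pr : probability Omega R).
Implicit Types (X Y : Omega -> R).

Definition Ex X : R := fine 'E_Pr[X]%E.
Definition L1 X := X \in Lfun Pr 1%E.
Definition L2 X := X \in Lfun Pr 2%:E.
Definition vL2 n (x : Omega -> 'cV[R]_n) : Prop := forall i, L2 (fun om => x om i 0).

Lemma EFin_Ex X : L1 X -> 'E_Pr[X]%E = (Ex X)%:E.
Proof. by move=> LX; rewrite /Ex fineK // expectation_fin_num. Qed.

Lemma L1D X Y : L1 X -> L1 Y -> L1 (fun om => X om + Y om).
Proof. exact: rpredD. Qed.

Lemma L1N X : L1 X -> L1 (fun om => - X om).
Proof. by move=> LX; rewrite /L1 (_ : (fun _ => _) = - X) // rpredN. Qed.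

Lemma L1Z a X : L1 X -> L1 (fun om => a * X om).
Proof. by move=> LX; rewrite /L1 (_ : (fun _ => _) = a *: X) // rpredZ. Qed.

Lemma L1_cst a : L1 (fun=> a).
Proof. exact: Lfun_cst. Qed.

Lemma L1_sum I (r : seq I) (P : pred I) (X : I -> Omega -> R) :
  (forall i, L1 (X i)) -> L1 (fun om => \sum_(i <- r | P i) X i om).
Proof.
move=> LX; rewrite /L1 (_ : (fun _ => _) = \sum_(i <- r | P i) X i); last first.
  by apply/funext => om; rewrite fct_sumE.
by apply: rpred_sum => i _; exact: LX.
Qed.

Lemma L2D X Y : L2 X -> L2 Y -> L2 (fun om => X om + Y om).
Proof.
have [_ h] := @Lfun_addr_closed _ _ _ Pr 2%:E (lee1n 2).
exact: h.
Qed.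

Lemma L2Z a X : L2 X -> L2 (fun om => a * X om).
Proof.
move=> LX; rewrite /L2 (_ : (fun _ => _) = a \o* X).
  by apply: Lfun_scale => //; rewrite ler1n.
by apply/funext => om; rewrite /= mulrC.
Qed.

Lemma L2_cst a : L2 (fun=> a).
Proof. exact: Lfun_cst. Qed.

Lemma L2_sum I (r : seq I) (P : pred I) (X : I -> Omega -> R) :
  (forall i, L2 (X i)) -> L2 (fun om => \sum_(i <- r | P i) X i om).
Proof.
move=> LX; elim: r => [|i r IH].
  by under eq_fun do rewrite big_nil; exact: L2_cst.
case Pi : (P i).
  by under eq_fun do rewrite big_cons Pi; exact: L2D.
by under eq_fun do rewrite big_cons Pi.
Qed.

Lemma L2_L1 X : L2 X -> L1 X.
Proof. by apply: Lfun_subset12; exact: fin_num_measure. Qed.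

Lemma L2M X Y : L2 X -> L2 Y -> L1 (fun om => X om * Y om).
Proof. exact: Lfun2_mul_Lfun1. Qed.

Lemma L1_bound X Y : measurable_fun setT X -> L1 Y ->
  (forall om, `|X om| <= Y om) -> L1 X.
Proof.
move=> mX LY XY; apply/Lfun1_integrable.
have iY : Pr.-integrable setT (EFin \o Y) by exact/Lfun1_integrable.
apply: (le_integrable _ _ _ iY) => //; first exact/measurable_EFinP.
by move=> om _ /=; rewrite lee_fin (le_trans (XY om)) // ler_norm.
Qed.

Lemma L2_of_sqr X : measurable_fun setT X -> L1 (fun om => X om ^+ 2) -> L2 X.
Proof.
move=> mX /Lfun1_integrable/integrableP[_ fX].
rewrite /L2 inE; apply/andP; split; rewrite inE //=.
rewrite /finite_norm unlock; apply: poweR_lty; apply: le_lt_trans fX.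
rewrite ge0_le_integral //=.
- apply/measurable_EFinP.
  apply: (@measurableT_comp _ _ _ _ _ _ (fun x : R => x `^ 2)) => //.
  exact: measurableT_comp.
- apply/measurable_EFinP; apply: measurableT_comp => //.
  exact: measurable_funX.
- by move=> om _; rewrite lee_fin powR_mulrn // normrX.
Qed.

Lemma ExD X Y : L1 X -> L1 Y -> Ex (fun om => X om + Y om) = Ex X + Ex Y.
Proof.
move=> LX LY; rewrite /Ex (_ : (fun _ => _) = X \+ Y) // expectationD //.
by rewrite fineD ?expectation_fin_num.
Qed.

Lemma ExZ a X : L1 X -> Ex (fun om => a * X om) = a * Ex X.
Proof.
move=> LX; rewrite /Ex (_ : (fun _ => _) = a \o* X); last first.
  by apply/funext => om; rewrite /= mulrC.
by rewrite expectationZl // fineM ?expectation_fin_num.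
Qed.

Lemma ExN X : L1 X -> Ex (fun om => - X om) = - Ex X.
Proof.
move=> LX; rewrite -mulN1r -ExZ //; congr Ex; apply/funext => om.
by rewrite mulN1r.
Qed.

Lemma Ex_cst a : Ex (fun=> a) = a.
Proof. by rewrite /Ex expectation_cst. Qed.

Lemma Ex_sum I (r : seq I) (P : pred I) (X : I -> Omega -> R) :
  (forall i, L1 (X i)) ->
  Ex (fun om => \sum_(i <- r | P i) X i om) = \sum_(i <- r | P i) Ex (X i).
Proof.
move=> LX; elim: r => [|i r IH].
  by rewrite big_nil -[RHS](Ex_cst 0); congr Ex; apply/funext => om; rewrite big_nil.
rewrite big_cons -IH; case: ifP => Pi.
  by rewrite -ExD //; [congr Ex; apply/funext => om; rewrite big_cons Pi|exact: L1_sum].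
by congr Ex; apply/funext => om; rewrite big_cons Pi.
Qed.

Lemma Ex_ge0 X : (forall om, 0 <= X om) -> 0 <= Ex X.
Proof. by move=> X0; rewrite /Ex fine_ge0 // expectation_ge0. Qed.

Lemma Ex_le X Y : L1 X -> L1 Y -> (forall om, X om <= Y om) -> Ex X <= Ex Y.
Proof.
move=> LX LY XY; rewrite -subr_ge0 -ExN // -ExD //; last exact: L1N.
by apply: Ex_ge0 => om; rewrite subr_ge0.
Qed.

End expectation.

(** * Measurability of matrices and adapted variables *)

Section matrix_measurability.
Context {R : realType}.

Lemma measurable_entry p q i j :
  measurable_fun setT (fun M : 'M[R]_(p, q) => M i j).
Proof.
move=> _ Y mY; rewrite setTI; apply: sub_sigma_algebra.
by exists i, j; exists Y.
Qed.

Lemma measurable_mxP d (T : measurableType d) p q (f : T -> 'M[R]_(p, q)) :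
  measurable_fun setT f <->
  forall i j, measurable_fun setT (fun t => f t i j).
Proof.
split=> [mf i j|mf].
  by apply: (measurableT_comp (measurable_entry i j)).
apply: (@measurability _ _ _ _ setT f (@mx_entry_preimages R p q)) => //.
move=> _ [_ [i [j [Y mY ->]]] <-].
exact: (mf i j).
Qed.

Context d (T : measurableType d).

Lemma measurable_addmx p q (f g : T -> 'M[R]_(p, q)) :
  measurable_fun setT f -> measurable_fun setT g ->
  measurable_fun setT (fun t => f t + g t).
Proof.
move=> /measurable_mxP mf /measurable_mxP mg; apply/measurable_mxP => i j.
under eq_fun do rewrite mxE; exact: measurable_funD.
Qed.

Lemma measurable_mulmx p q r (M : 'M[R]_(p, q)) (f : T -> 'M[R]_(q, r)) :
  measurable_fun setT f -> measurable_fun setT (fun t => M *m f t).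
Proof.
move=> /measurable_mxP mf; apply/measurable_mxP => i j.
under eq_fun do rewrite mxE.
by apply: measurable_sum => k; apply: measurable_funM.
Qed.

End matrix_measurability.

Section square_integrable_vectors.
Context {R : realType} {d} {Omega : measurableType d} (Pr : probability Omega R).

Lemma vL2D n (x y : Omega -> 'cV[R]_n) : vL2 Pr x -> vL2 Pr y ->
  vL2 Pr (fun om => x om + y om).
Proof. by move=> Lx Ly i; under eq_fun do rewrite mxE; exact: L2D. Qed.

Lemma vL2_mulmx n p (M : 'M[R]_(p, n)) (x : Omega -> 'cV[R]_n) : vL2 Pr x ->
  vL2 Pr (fun om => M *m x om).
Proof.
move=> Lx i; under eq_fun do rewrite mxE.
by apply: L2_sum => j; exact: L2Z.
Qed.

Lemma vL2_cst n (x : 'cV[R]_n) : vL2 Pr (fun=> x).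
Proof. by move=> i; exact: L2_cst. Qed.

Lemma vL2N n (x : Omega -> 'cV[R]_n) : vL2 Pr x -> vL2 Pr (fun om => - x om).
Proof.
move=> Lx; rewrite (_ : (fun _ => _) = fun om => (- 1%:M) *m x om).
  exact: vL2_mulmx.
by apply/funext => om; rewrite mulNmx mul1mx.
Qed.

Lemma L1_bil p q (M : 'M[R]_(p, q)) x y : vL2 Pr x -> vL2 Pr y ->
  L1 Pr (fun om => bil M (x om) (y om)).
Proof.
move=> Lx Ly; under eq_fun do rewrite bilE.
by apply: L1_sum => i; apply: L1_sum => j; apply: L1Z; exact: L2M.
Qed.

Lemma L1_quad n (M : 'M[R]_n) x : vL2 Pr x -> L1 Pr (fun om => quad M (x om)).
Proof. by move=> Lx; exact: L1_bil. Qed.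

Lemma L1_sqnorm n (x : Omega -> 'cV[R]_n) :
  vL2 Pr x -> L1 Pr (fun om => sqnorm (x om)).
Proof. by move=> Lx; under eq_fun do rewrite sqnorm_quad; exact: L1_quad. Qed.

Lemma L1_dot n (b : 'cV[R]_n) x : vL2 Pr x -> L1 Pr (fun om => dot b (x om)).
Proof.
move=> Lx; under eq_fun do rewrite dot_bil.
by apply: L1_bil => //; exact: vL2_cst.
Qed.

Lemma L1_quadlin n (M : 'M[R]_n) b x : vL2 Pr x ->
  L1 Pr (fun om => quadlin M b (x om)).
Proof. by move=> Lx; apply: L1D; [exact: L1_quad|exact: L1_dot]. Qed.

End square_integrable_vectors.

Section adapted.
Context {R : realType} {d} {Omega : measurableType d}.
Context {dS} {S : measurableType dS} {n : nat}.
Variables (w : nat -> Omega -> 'cV[R]_n) (xi : nat -> Omega -> S).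

Definition past (t : nat) (om : Omega) : t.-tuple 'cV[R]_n * t.+1.-tuple S :=
  ([tuple w s om | s < t], [tuple xi s om | s < t.+1]).

(** The random variables determined by the noises before [t] and the seeds up to
    [t], that is, those with which [w t] is uncorrelated. *)
Definition adapted d' (T : measurableType d') (t : nat) (X : Omega -> T) :=
  exists2 f, measurable_fun setT f & forall om, X om = f (past t om).

Lemma adapted_comp d1 d2 (T1 : measurableType d1) (T2 : measurableType d2)
    (h : T1 -> T2) t (X : Omega -> T1) :
  measurable_fun setT h -> adapted t X -> adapted t (fun om => h (X om)).
Proof.
move=> mh [f mf Xf]; exists (h \o f); first exact: measurableT_comp.
by move=> om; rewrite Xf.
Qed.

Lemma adapted_pair d1 d2 (T1 : measurableType d1) (T2 : measurableType d2)
    t (X : Omega -> T1) (Y : Omega -> T2) :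
  adapted t X -> adapted t Y -> adapted t (fun om => (X om, Y om)).
Proof.
move=> [f mf Xf] [h mh Yh]; exists (fun p => (f p, h p)).
  exact: measurable_fun_pair.
by move=> om; rewrite Xf Yh.
Qed.

Lemma adapted_tuple d1 (T1 : measurableType d1) k t (X : 'I_k -> Omega -> T1) :
  (forall i, adapted t (X i)) -> adapted t (fun om => [tuple X i om | i < k]).
Proof.
move=> aX.
have /choice[f fP] : forall i, exists f, measurable_fun setT f /\
    forall om, X i om = f (past t om).
  by move=> i; have [f mf Xf] := aX i; exists f.
exists (fun p => [tuple f i p | i < k]).
  apply/measurable_fun_tnthP => i; have [mf _] := fP i.
  by rewrite (_ : _ \o _ = f i) //; apply/funext => p /=; rewrite tnth_mktuple.
move=> om; apply: eq_from_tnth => i; rewrite !tnth_mktuple.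
exact: (fP i).2.
Qed.

Lemma adapted_cst d1 (T1 : measurableType d1) t (x : T1) : adapted t (fun=> x).
Proof. by exists (fun=> x). Qed.

Lemma adapted_noise s t : (s < t)%N -> adapted t (w s).
Proof.
move=> st; exists (fun p => tnth p.1 (Ordinal st)).
  exact: (measurableT_comp (measurable_tnth _)).
by move=> om; rewrite /= tnth_mktuple.
Qed.

Lemma adapted_seed s t : (s <= t)%N -> adapted t (xi s).
Proof.
rewrite -ltnS => st; exists (fun p => tnth p.2 (Ordinal st)).
  exact: (measurableT_comp (measurable_tnth _)).
by move=> om; rewrite /= tnth_mktuple.
Qed.

Lemma adapted_past s t : (s <= t)%N -> adapted t (past s).
Proof.
move=> st; apply: adapted_pair.
  by apply: adapted_tuple => i; apply: adapted_noise; exact: leq_trans st.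
by apply: adapted_tuple => i; apply: adapted_seed; rewrite (leq_trans _ st) // -ltnS.
Qed.

Lemma adapted_le d1 (T1 : measurableType d1) s t (X : Omega -> T1) :
  (s <= t)%N -> adapted s X -> adapted t X.
Proof.
move=> st [f mf Xf]; have [h mh hP] := adapted_comp mf (adapted_past st).
by exists h => // om; rewrite Xf hP.
Qed.

Lemma adaptedD p q t (X Y : Omega -> 'M[R]_(p, q)) :
  adapted t X -> adapted t Y -> adapted t (fun om => X om + Y om).
Proof.
move=> [f mf Xf] [h mh Yh]; exists (fun z => f z + h z).
  exact: measurable_addmx.
by move=> om; rewrite Xf Yh.
Qed.

Lemma adapted_mulmx p q r t (M : 'M[R]_(p, q)) (X : Omega -> 'M[R]_(q, r)) :
  adapted t X -> adapted t (fun om => M *m X om).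
Proof. by apply: adapted_comp; apply: measurable_mulmx; exact: measurable_id. Qed.

Hypotheses (w_meas : forall t, measurable_fun setT (w t))
  (xi_meas : forall t, measurable_fun setT (xi t)).

Lemma adapted_measurable d1 (T1 : measurableType d1) t (X : Omega -> T1) :
  adapted t X -> measurable_fun setT X.
Proof.
move=> [f mf Xf]; rewrite (_ : X = f \o past t); last exact/funext.
apply: measurableT_comp => //; apply: measurable_fun_pair.
  apply/measurable_fun_tnthP => i; rewrite (_ : _ \o _ = w i) //.
  by apply/funext => om /=; rewrite tnth_mktuple.
apply/measurable_fun_tnthP => i; rewrite (_ : _ \o _ = xi i) //.
by apply/funext => om /=; rewrite tnth_mktuple.
Qed.

Context {m : nat}.
Variables (A : 'M[R]_n) (B : 'M[R]_(n, m)) (x0 : 'cV[R]_n).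

(** Unfolding the policy along the trajectory removes the histories: states and
    controls become measurable functions of the past noises and seeds. *)
Lemma policy_adapted u : is_policy A B x0 w xi u ->
  forall t, adapted t (state A B x0 w u t) /\ adapted t (u t).
Proof.
move=> pol; elim/ltn_ind => t IH.
have ast : adapted t (state A B x0 w u t).
  case: t IH => [|t] IH; first exact: adapted_cst.
  have [ax au] := IH t (leqnn _).
  apply: adaptedD; last exact: adapted_noise.
  by apply: (@adapted_le _ _ t) => //; apply: adaptedD; exact: adapted_mulmx.
split=> //; have [pi mpi piE] := pol t.
rewrite (_ : u t = fun om => pi (([tuple state A B x0 w u s om | s < t.+1],
  [tuple u s om | s < t]), xi t om)); last exact/funext.
apply: adapted_comp => //; apply: adapted_pair; last exact: adapted_seed.
apply: adapted_pair; apply: adapted_tuple => i.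
  have := ltn_ord i; rewrite ltnS leq_eqVlt => /orP[/eqP -> //|it].
  by apply: (adapted_le (ltnW it)); have [] := IH _ it.
by apply: (adapted_le (ltnW (ltn_ord i))); have [] := IH _ (ltn_ord i).
Qed.

Lemma feedback_policy (phi : 'cV[R]_n -> 'cV[R]_m) : measurable_fun setT phi ->
  is_policy A B x0 w xi (feedback A B x0 w phi).
Proof.
move=> mphi t.
exists (fun p => phi (tnth p.1.1 ord_max)).
  apply: (measurableT_comp mphi); apply: (measurableT_comp (measurable_tnth _)).
  exact: measurableT_comp.
by move=> om; rewrite tnth_mktuple /= state_feedback.
Qed.

End adapted.

(** * One step of noise *)

Section noise.
Context {R : realType} {d} {Omega : measurableType d} (Pr : probability Omega R).
Context {dS} {S : measurableType dS} {n : nat}.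
Variables (w : nat -> Omega -> 'cV[R]_n) (xi : nat -> Omega -> S).
Variables (wbar : 'cV[R]_n) (W : 'M[R]_n).
Hypotheses (w_L2 : forall t, vL2 Pr (w t)) (w_uncorr : uncorrelated_noise Pr w xi).
Hypotheses (wbarE : forall t, wbar = mx_expectation Pr (w t))
  (WE : forall t, W =
     mx_expectation Pr (fun om => (w t om - wbar) *m (w t om - wbar)^T)).

Local Notation Ex := (Ex Pr).

Lemma vL2_noise_centered t : vL2 Pr (fun om => w t om - wbar).
Proof. by apply: vL2D => //; exact: vL2_cst. Qed.

Lemma Ex_centered_noise t i : Ex (fun om => (w t om - wbar) i 0) = 0.
Proof.
under [X in Ex X]eq_fun do rewrite mxE.
rewrite ExD; last 2 first.
- by apply: L2_L1; exact: w_L2.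
- by apply: L2_L1; under eq_fun do rewrite mxE; exact: L2_cst.
under [X in _ + Ex X]eq_fun do rewrite mxE.
by rewrite Ex_cst (wbarE t) mxE /Ex subrr.
Qed.

Lemma Ex_centered_noise_past t (X : Omega -> R) i : adapted w xi t X -> L2 Pr X ->
  Ex (fun om => X om * (w t om - wbar) i 0) = 0.
Proof.
move=> [f mf Xf] LX.
have XE : X = fun om => f (past w xi t om) by apply/funext.
have Lw := w_L2 t i; have L1w := L2_L1 Lw; have L1X := L2_L1 LX.
have := @w_uncorr t f mf _ i; rewrite -/(past w xi t) -XE => /(_ LX).
have LwX : L1 Pr (fun om => w t om i 0 * X om) by exact: L2M.
rewrite covarianceE // -/Ex.
rewrite !EFin_Ex // -EFinM -EFinB => -[].
have -> : (fun om => X om * (w t om - wbar) i 0) =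
    (fun om => w t om i 0 * X om + - wbar i 0 * X om).
  by apply/funext => om; rewrite !mxE; ring.
rewrite ExD // ?ExZ //; last exact: L1Z.
have -> : wbar i 0 = Ex (fun om => w t om i 0) by rewrite (wbarE t) mxE.
by rewrite mulNr.
Qed.

(** The expectation of [quad M] at the centered noise, that is [\tr (M *m W)]
    as [W] is symmetric. *)
Definition noise_trace (M : 'M[R]_n) : R := \sum_i \sum_j M i j * W i j.

Lemma Ex_quad_centered_noise t M :
  Ex (fun om => quad M (w t om - wbar)) = noise_trace M.
Proof.
have L := vL2_noise_centered t.
under [X in Ex X]eq_fun do rewrite quad_bil bilE.
have L2ij i j : L1 Pr (fun om => M i j *
    ((w t om - wbar) i 0 * (w t om - wbar) j 0)).
  by apply: L1Z; exact: L2M.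
rewrite Ex_sum => [|i]; last by apply: L1_sum => j.
apply: eq_bigr => i _; rewrite Ex_sum //; apply: eq_bigr => j _.
rewrite ExZ; last exact: L2M.
congr (_ * _); rewrite (WE t) mxE /Ex; congr fine; congr expectation.
by apply/funext => om; rewrite [RHS]mxE big_ord1 [_^T _ _]mxE.
Qed.

(** [quad W x] is the expectation of the square of [dot x] at the centered
    noise. *)
Lemma noise_covariance_psd x : 0 <= quad W x.
Proof.
have L := vL2_noise_centered 0%N.
have <- : Ex (fun om => quad (x *m x^T) (w 0%N om - wbar)) = quad W x.
  rewrite Ex_quad_centered_noise quad_bil bilE.
  by apply: eq_bigr => i _; apply: eq_bigr => j _; rewrite mxE big_ord1 mxE mulrC.
apply: Ex_ge0 => om; have -> : quad (x *m x^T) (w 0%N om - wbar) =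
    quad 1%:M (x^T *m (w 0%N om - wbar)).
  by rewrite quad_mul trmxK mulmx1.
by rewrite -sqnorm_quad sqnorm_ge0.
Qed.

Lemma Ex_bil_centered_noise t M (y : Omega -> 'cV[R]_n) :
  adapted w xi t y -> vL2 Pr y ->
  Ex (fun om => bil M (y om) (w t om - wbar)) = 0.
Proof.
move=> ay Ly; have L := vL2_noise_centered t.
under [X in Ex X]eq_fun do rewrite bilE.
have L2ij i j : L1 Pr (fun om => M i j * (y om i 0 * (w t om - wbar) j 0)).
  by apply: L1Z; exact: L2M.
rewrite Ex_sum => [|i]; last by apply: L1_sum => j.
rewrite big1 // => i _; rewrite Ex_sum // big1 // => j _.
rewrite ExZ; last exact: L2M.
rewrite Ex_centered_noise_past ?mulr0 //.
exact: (adapted_comp (measurable_entry i 0)).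
Qed.

(** The noise enters an expected quadratic function of [z + w_t] only through
    its mean and its covariance: the cross terms vanish since [z] depends on
    the past alone. *)
Lemma Ex_quadlin_noise t M b (z : Omega -> 'cV[R]_n) :
  adapted w xi t z -> vL2 Pr z ->
  Ex (fun om => quadlin M b (z om + w t om)) =
  Ex (fun om => quadlin M b (z om + wbar)) + noise_trace M.
Proof.
move=> az Lz; have L := vL2_noise_centered t.
have Ly : vL2 Pr (fun om => z om + wbar) by apply: vL2D => //; exact: vL2_cst.
have ay : adapted w xi t (fun om => z om + wbar).
  by apply: adaptedD => //; exact: adapted_cst.
have -> : (fun om => quadlin M b (z om + w t om)) = (fun om =>
    quadlin M b (z om + wbar) + (bil (M + M^T) (z om + wbar) (w t om - wbar)
    + (dot b (w t om - wbar) + quad M (w t om - wbar)))).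
  apply/funext => om.
  have -> : z om + w t om = (z om + wbar) + (w t om - wbar).
    by rewrite addrACA subrr addr0.
  move: (z om + wbar) (w t om - wbar) => y v.
  rewrite /quadlin !quad_bil bilMD -bil_tr !bilDl !bilDr !dotDr; ring.
have Lq := L1_quad M L; have Ld := L1_dot b L.
have Lb := L1_bil (M + M^T) Ly L; have Lql := L1_quadlin M b Ly.
have Ldq : L1 Pr (fun om => dot b (w t om - wbar) + quad M (w t om - wbar)).
  exact: L1D.
rewrite [LHS]ExD //; last exact: L1D.
congr (_ + _); rewrite ExD // ExD //.
rewrite Ex_bil_centered_noise // Ex_quad_centered_noise add0r.
have -> : Ex (fun om => dot b (w t om - wbar)) = 0; last by rewrite add0r.
under [X in Ex X]eq_fun do rewrite dotE.
rewrite Ex_sum => [|i]; last by apply: L1Z; exact: L2_L1.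
rewrite big1 // => i _; rewrite ExZ; last exact: L2_L1.
by rewrite Ex_centered_noise mulr0.
Qed.

End noise.

(** * Time averages *)

Section time_averages.
Context {R : realType}.
Implicit Types (a b : nat -> R).

Definition time_average a (T : nat) : R := T%:R^-1 * \sum_(t < T) a t.

Lemma time_averageD a b T : time_average (fun t => a t + b t) T = time_average a T + time_average b T.
Proof. by rewrite /time_average big_split mulrDr. Qed.

Lemma time_averageZ k a T : time_average (fun t => k * a t) T = k * time_average a T.
Proof. by rewrite /time_average -mulr_sumr mulrCA. Qed.

Lemma time_average_le a b T : (forall t, a t <= b t) -> time_average a T <= time_average b T.
Proof. by move=> ab; rewrite ler_wpM2l ?invr_ge0 // ler_sum. Qed.

Lemma time_average_ge0 a T : (forall t, 0 <= a t) -> 0 <= time_average a T.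
Proof. by move=> a0; rewrite mulr_ge0 ?invr_ge0 // sumr_ge0. Qed.

Lemma time_average_cst (k : R) T : (0 < T)%N -> time_average (fun=> k) T = k.
Proof.
move=> T0; rewrite /time_average sumr_const card_ord -[k *+ T]mulr_natl mulrA mulVf ?mul1r //.
by rewrite pnatr_eq0 -lt0n.
Qed.

Lemma time_average_le_cst a k T : 0 <= k -> (forall t, a t <= k) -> time_average a T <= k.
Proof.
move=> k0 ak; case: T => [|T]; first by rewrite /time_average big_ord0 mulr0.
by rewrite -[leRHS](@time_average_cst k T.+1) // time_average_le.
Qed.

(** Partial sums that are affine in [T] up to a bounded error have converging
    averages. *)
Lemma time_average_cvg a l (e : nat -> R) K :
  (forall T, \sum_(t < T) a t = T%:R * l + e T) -> (forall T, `|e T| <= K) ->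
  time_average a @ \oo --> l.
Proof.
move=> aE eK; rewrite -[l]addr0.
have : (fun T : nat => l + T%:R^-1 * e T) @ \oo --> l + 0.
  apply: cvgD; first exact: cvg_cst.
  apply: norm_cvg0.
  apply: (@squeeze_cvgr _ _ _ _ (fun=> 0) (fun T : nat => T%:R^-1 * K)).
  - apply: nearW => T; rewrite normr_ge0 normrM ger0_norm ?invr_ge0 //.
    by rewrite ler_wpM2l // invr_ge0.
  - exact: cvg_cst.
  - rewrite -[X in _ --> X](mul0r K); apply: cvgMl.
    apply/gtr0_cvgV0; last exact: cvgr_idn.
    by near=> T; rewrite ltr0n; near: T; exact: nbhs_infty_gt.
apply: cvg_trans; apply: near_eq_cvg; near=> T.
have T0 : (T%:R : R) != 0 by rewrite pnatr_eq0 -lt0n; near: T; exact: nbhs_infty_gt.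
by rewrite /time_average aE mulrDr mulrA mulVf // mul1r.
Unshelve. all: by end_near. Qed.

Lemma le_cvg_near (u v : nat -> R) l k : u @ \oo --> l -> v @ \oo --> k ->
  (forall T, u T <= v T) -> l <= k.
Proof. by move=> ul vk uv; apply: (ler_cvg_to ul vk); exact: nearW. Qed.

Lemma limn_esup_lt (u : (\bar R)^nat) l : (limn_esup u < l)%E ->
  \forall T \near \oo, (u T < l)%E.
Proof.
rewrite /limn_esup limf_esupE => /ereal_inf_lt[_ [V VF <-]] supl.
by apply: filterS VF => T VT; apply: le_lt_trans supl; apply: ereal_sup_ubound; exists T.
Qed.

Lemma sum_shift_le (j : nat -> R) i N T : (forall t, 0 <= j t) -> (i <= N)%N ->
  \sum_(t < T) j (t + i)%N <= \sum_(t < T + N) j t.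
Proof.
move=> j0 iN; rewrite -(big_mkord xpredT (fun t => j (t + i)%N)).
rewrite -(big_mkord xpredT j).
have <- : \sum_(i <= t < T + i) j t = \sum_(0 <= t < T) j (t + i)%N.
  by rewrite -{1}[i]add0n big_addn addnK.
rewrite (@big_cat_nat _ _ _ i 0 (T + N)) //=; last first.
  by rewrite (leq_trans iN) // leq_addl.
rewrite [X in _ <= _ + X](@big_cat_nat _ _ _ (T + i)) ?leq_addl ?leq_add2l //=.
by rewrite addrCA lerDl addr_ge0 // sumr_ge0.
Qed.

(** A nonnegative sequence with linearly growing sums is small against [T]
    infinitely often: [s t > e t] on [T, 2T[ would make the sum quadratic. *)
Lemma frequently_sublinear (s : nat -> R) M e N : (forall t, 0 <= s t) -> 0 < e ->
  (\forall T \near \oo, \sum_(t < T) s t <= M * T.+1%:R) ->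
  exists2 T, (N <= T)%N & s T <= e * T%:R.
Proof.
move=> s0 e0 [N1 _ sM]; apply: contrapT => noT.
have big t : (N <= t)%N -> e * t%:R < s t.
  by move=> Nt; rewrite ltNge; apply/negP => h; apply: noT; exists t.
have [T TM] : exists T : nat, `|M| * 3 / e < T%:R.
  by exists (Num.truncn (`|M| * 3 / e)).+1; rewrite truncnS_gt.
pose T1 := (T + N + N1).+1.
have T1M : `|M| * 3 < e * T1%:R.
  rewrite -ltr_pdivrMl // mulrC (lt_le_trans TM) // ler_nat /T1.
  by rewrite ltnW // ltnS -addnA leq_addr.
have NT1 : (N1 <= T1 + T1)%N.
  by rewrite (leq_trans _ (leq_addr _ _)) // /T1 ltnW // ltnS leq_addl.
have := sM _ NT1; rewrite /= -(big_mkord xpredT s).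
rewrite (@big_cat_nat _ _ _ T1 0) ?leq_addr //= => h.
have h1 : T1%:R * (e * T1%:R) <= \sum_(T1 <= t < T1 + T1) s t.
  rewrite mulr_natl -[X in _ *+ X](addnK T1) -sumr_const_nat ler_sum_nat // => t.
  move=> /andP[T1t _]; apply: (@le_trans _ _ (e * t%:R)).
    by rewrite ler_pM2l // ler_nat.
  apply: ltW; apply: big; apply: leq_trans T1t.
  by rewrite /T1 ltnW // ltnS addnAC leq_addl.
have h0 : 0 <= \sum_(0 <= t < T1) s t by exact: sumr_ge0.
have T1p : 1 <= T1%:R :> R by rewrite ler1n.
have h2 : M * (T1 + T1).+1%:R <= `|M| * (3 * T1%:R).
  apply: (@le_trans _ _ (`|M| * (T1 + T1).+1%:R)).
    by rewrite ler_wpM2r // ler_norm.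
  by rewrite ler_wpM2l // -natr1 natrD; lra.
have h3 : T1%:R * (`|M| * 3) < T1%:R * (e * T1%:R).
  by rewrite ltr_pM2l // (lt_le_trans ltr01).
lra.
Qed.

End time_averages.

(** * Controlled trajectories: Bellman identity, duality, coupling *)

Section controlled_system.
Context {R : realType} {n m : nat}.
Context {d} {Omega : measurableType d} (Pr : probability Omega R).
Context {dS} {S : measurableType dS}.
Variables (xi : nat -> Omega -> S) (w : nat -> Omega -> 'cV[R]_n).
Variables (A : 'M[R]_n) (B : 'M[R]_(n, m)) (x0 : 'cV[R]_n).
Variables (Q : 'M[R]_n) (Ru : 'M[R]_m).
Variables (wbar : 'cV[R]_n) (W : 'M[R]_n) (M3 : 'cV[R]_n).
Hypotheses (xi_meas : forall t, measurable_fun setT (xi t))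
  (w_meas : forall t, measurable_fun setT (w t)).
Hypotheses (w_L2 : forall t, vL2 Pr (w t)) (w_uncorr : uncorrelated_noise Pr w xi).
Hypotheses (wbarE : forall t, wbar = mx_expectation Pr (w t))
  (WE : forall t, W =
     mx_expectation Pr (fun om => (w t om - wbar) *m (w t om - wbar)^T)).
Hypotheses (Qpsd : psdmx Q) (Rpd : pdmx Ru).

Implicit Types (u : nat -> Omega -> 'cV[R]_m) (lam mu eps : R).

Local Notation Ex := (Ex Pr).
Local Notation st := (state A B x0 w).
Local Notation trW := (noise_trace W).

Definition square_integrable_policy u : Prop := forall t,
  [/\ adapted w xi t (st u t), adapted w xi t (u t),
      vL2 Pr (st u t) & vL2 Pr (u t)].

Section square_integrable.
Variable u : nat -> Omega -> 'cV[R]_m.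
Hypothesis usq : square_integrable_policy u.

Lemma Ex_quadlin_next M b t :
  Ex (fun om => quadlin M b (st u t.+1 om)) =
  Ex (fun om => quadlin M b (A *m st u t om + B *m u t om + wbar)) + trW M.
Proof.
have [ax au Lx Lu] := usq t.
apply: (Ex_quadlin_noise w_L2 w_uncorr wbarE WE).
  by apply: adaptedD; exact: adapted_mulmx.
by apply: vL2D; exact: vL2_mulmx.
Qed.

Lemma L1_lqr_cost t : L1 Pr (fun om => lqr_stage_cost Q Ru (st u t om) (u t om)).
Proof. by have [_ _ Lx Lu] := usq t; apply: L1D; exact: L1_quad. Qed.

Lemma risk_stage_costE (x : 'cV[R]_n) (v : 'cV[R]_m) :
  risk_stage_cost Q W M3 x v =
  quadlin (4 *: (Q *m W *m Q)) (4 *: (Q *m M3)) x.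
Proof.
rewrite /quadlin dotZl quad_bil bilMZ -quad_bil dotC -bil_dot.
by rewrite /risk_stage_cost.
Qed.

Lemma L1_risk_cost t :
  L1 Pr (fun om => risk_stage_cost Q W M3 (st u t om) (u t om)).
Proof.
have [_ _ Lx Lu] := usq t.
under eq_fun do rewrite risk_stage_costE; exact: L1_quadlin.
Qed.

Lemma L1_lagrangian_cost lam t :
  L1 Pr (fun om => lagrangian_cost Q Ru W M3 lam (st u t om) (u t om)).
Proof.
by apply: L1D; [exact: L1_lqr_cost|apply: L1Z; exact: L1_risk_cost].
Qed.

Lemma average_costE c :
  (forall t, L1 Pr (fun om => c (st u t om) (u t om))) ->
  average_cost Pr A B x0 c w u = limn_esup (fun T : nat =>
    (time_average (fun t => Ex (fun om => c (st u t om) (u t om))) T)%:E).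
Proof.
move=> Lc; rewrite /average_cost; congr limn_esup; apply/funext => T.
rewrite EFin_Ex; last exact: L1_sum.
by rewrite -EFinM /time_average Ex_sum.
Qed.

Lemma average_cost_cvg c l :
  (forall t, L1 Pr (fun om => c (st u t om) (u t om))) ->
  time_average (fun t => Ex (fun om => c (st u t om) (u t om))) @ \oo --> l ->
  average_cost Pr A B x0 c w u = l%:E.
Proof.
move=> Lc cl; rewrite average_costE // is_cvg_limn_esupE; last first.
  by apply/cvg_ex; exists l%:E; apply: cvg_EFin; [exact: nearW|].
by apply: cvg_lim => //; apply: cvg_EFin; [exact: nearW|].
Qed.

Lemma average_cost_lt c a :
  (forall t, L1 Pr (fun om => c (st u t om) (u t om))) ->
  (average_cost Pr A B x0 c w u < a%:E)%E ->
  \forall T \near \oo,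
    time_average (fun t => Ex (fun om => c (st u t om) (u t om))) T < a.
Proof.
by move=> Lc; rewrite average_costE // => /limn_esup_lt; apply: filterS => T; rewrite lte_fin.
Qed.

Section multiplier.
Variables (lam : R) (P : 'M[R]_n) (g : 'cV[R]_n).
Hypotheses (Ppsd : psdmx P) (ricP : riccati A B Q Ru W lam P).
Hypothesis (ling : linear_term A B Q Ru wbar M3 lam P g).

Local Notation phi := (affine_law A B Ru wbar P g).
Local Notation H := (lqr_hessian B Ru P).

(** The optimal average of the Lagrangian cost, thus the Lagrange dual function
    at the multiplier to which [P] and [g] belong. *)
Definition dual_value : R := lqr_constant B Ru wbar P g + trW P.

(** By the Bellman equation this is what the control at time [t] loses against
    the affine law in terms of the Lagrangian cost. *)
Definition regret (t : nat) : R := Ex (fun om => quad H (u t om - phi (st u t om))).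

Lemma vL2_affine_law (x : Omega -> 'cV[R]_n) : vL2 Pr x -> vL2 Pr (fun om => phi (x om)).
Proof.
by move=> Lx; apply: vL2D; [apply: vL2N; exact: vL2_mulmx|exact: vL2_cst].
Qed.

Lemma vL2_deviation t : vL2 Pr (fun om => u t om - phi (st u t om)).
Proof.
have [_ _ Lx Lu] := usq t; apply: vL2D => //; apply: vL2N; exact: vL2_affine_law.
Qed.

Lemma regret_ge0 t : 0 <= regret t.
Proof.
apply: Ex_ge0 => om; have [_ Hp] := lqr_hessian_pd B Rpd Ppsd.
by have [->|/Hp/ltW//] := eqVneq (u t om - phi (st u t om)) 0; rewrite quad0.
Qed.

Lemma bellman_step t :
  Ex (fun om => lagrangian_cost Q Ru W M3 lam (st u t om) (u t om)) =
  dual_value + Ex (fun om => quadlin P g (st u t om))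
  - Ex (fun om => quadlin P g (st u t.+1 om)) + regret t.
Proof.
have [ax au Lx Lu] := usq t.
have Lz : vL2 Pr (fun om => A *m st u t om + B *m u t om + wbar).
  apply: vL2D; last exact: vL2_cst.
  by apply: vL2D; exact: vL2_mulmx.
have Ld := L1_quad H (vL2_deviation t).
have LV := L1_quadlin P g Lx; have LV' := L1_quadlin P g Lz.
have Ll := L1_lagrangian_cost lam t.
rewrite Ex_quadlin_next /dual_value /regret.
have : Ex (fun om => quadlin P g (A *m st u t om + B *m u t om + wbar)
    + lagrangian_cost Q Ru W M3 lam (st u t om) (u t om)) =
  Ex (fun om => quadlin P g (st u t om) + quad H (u t om - phi (st u t om))
    + lqr_constant B Ru wbar P g).
  by congr Ex; apply/funext => om; exact: completion_of_squares.
rewrite ExD // ExD //; [|exact: L1D|exact: L1_cst].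
rewrite ExD // Ex_cst; lra.
Qed.

Lemma bellman_sum T :
  \sum_(t < T) Ex (fun om => lagrangian_cost Q Ru W M3 lam (st u t om) (u t om)) =
  T%:R * dual_value + (Ex (fun om => quadlin P g (st u 0 om))
  - Ex (fun om => quadlin P g (st u T om))) + \sum_(t < T) regret t.
Proof.
elim: T => [|T IH]; first by rewrite !big_ord0 mul0r subrr !addr0.
rewrite !big_ord_recr /= IH bellman_step -natr1; ring.
Qed.

End multiplier.
End square_integrable.

Lemma affine_law_policy P g :
  is_policy A B x0 w xi (feedback A B x0 w (affine_law A B Ru wbar P g)).
Proof.
apply: feedback_policy.
rewrite (_ : affine_law A B Ru wbar P g =
  fun x => (- lqr_gain A B Ru P) *m x + lqr_offset B Ru wbar P g).
  apply: measurable_addmx; last exact: measurable_cst.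
  by apply: measurable_mulmx; exact: measurable_id.
by apply/funext => x; rewrite mulNmx.
Qed.

Lemma feedback_square_integrable P g :
  square_integrable_policy (feedback A B x0 w (affine_law A B Ru wbar P g)).
Proof.
have pol := affine_law_policy P g.
move=> t; have [ax au] := policy_adapted pol t; split => //.
  elim: t {ax au} => [|t IH]; first exact: vL2_cst.
  apply: vL2D => //; apply: vL2D; apply: vL2_mulmx => //.
  rewrite /feedback; under eq_fun do rewrite -state_feedback.
  exact: vL2_affine_law.
rewrite /feedback; under eq_fun do rewrite -state_feedback.
apply: vL2_affine_law; elim: t {ax au} => [|t IH]; first exact: vL2_cst.
apply: vL2D => //; apply: vL2D; apply: vL2_mulmx => //.
rewrite /feedback; under eq_fun do rewrite -state_feedback.
exact: vL2_affine_law.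
Qed.

Lemma Ex_sqnorm_noise b t : Ex (fun om => sqnorm (b + w t om)) =
  sqnorm (b + wbar) + trW 1%:M.
Proof.
have sE (x : 'cV[R]_n) : sqnorm x = quadlin 1%:M 0 x.
  by rewrite /quadlin sqnorm_quad dot_bil bil0l addr0.
under [X in Ex X]eq_fun do rewrite sE.
rewrite (@Ex_quadlin_noise _ _ _ _ _ _ _ _ xi _ _ w_L2 w_uncorr wbarE WE _ _ _ (fun=> b)).
- by rewrite Ex_cst -sE.
- exact: adapted_cst.
- exact: vL2_cst.
Qed.

Section stable_feedback.
Variables (P : 'M[R]_n) (g : 'cV[R]_n) (X : 'M[R]_n) (r C : R).
Local Notation F := (closed_loop A B Ru P).
Hypothesis lyap : lyapunov F X r C.
Local Notation phi := (affine_law A B Ru wbar P g).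
Local Notation l := (lqr_offset B Ru wbar P g).
Local Notation x := (st (feedback A B x0 w phi)).

Let usq := @feedback_square_integrable P g.

Lemma feedback_closed_loop t om :
  x t.+1 om = F *m x t om + (B *m l + w t om).
Proof.
rewrite /= /feedback -state_feedback /closed_loop /affine_law mulmxBl mulmxDr.
by rewrite mulmxN !mulmxA !addrA.
Qed.

Lemma feedback_drift t om :
  A *m x t om + B *m feedback A B x0 w phi t om + wbar =
  F *m x t om + (B *m l + wbar).
Proof.
rewrite /feedback -state_feedback /closed_loop /affine_law mulmxBl mulmxDr.
by rewrite mulmxN !mulmxA !addrA.
Qed.

(** The Lyapunov inequality with [v_t = B l + w_t], whose second moment does not
    depend on [t], is an affine contraction for the expectation of [quad X]. *)
Lemma feedback_bounded : exists2 K, 0 <= K & forall t, Ex (fun om => sqnorm (x t om)) <= K.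
Proof.
have [XT /andP[r0 r1] C0 XC dec] := lyap.
have r1' : 0 < 1 - r by rewrite subr_gt0.
have L t : vL2 Pr (x t) by have [] := usq t.
pose k := C * (sqnorm (B *m l + wbar) + trW 1%:M) / (1 - r).
have k0 : 0 <= k.
  rewrite divr_ge0 ?(ltW r1') // mulr_ge0 // -(Ex_sqnorm_noise _ 0).
  by apply: Ex_ge0 => om; exact: sqnorm_ge0.
have q0 := lyapunov_ge0 lyap x0.
exists (C * (quad X x0 + k)); first by rewrite mulr_ge0 // addr_ge0.
move=> t; apply: (@le_trans _ _ (C * Ex (fun om => quad X (x t om)))).
  rewrite -ExZ; last exact: L1_quad.
  by apply: Ex_le => //; [exact: L1_sqnorm|apply: L1Z; exact: L1_quad].
rewrite ler_wpM2l //; elim: t => [|t IH]; first by rewrite (Ex_cst Pr (quad X x0)) lerDl.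
have Lw : vL2 Pr (fun om => B *m l + w t om) by apply: vL2D => //; exact: vL2_cst.
have LX := L1_quad X (L t); have LXn := L1_quad X (L t.+1).
have Ls := L1_sqnorm Lw.
have h : Ex (fun om => quad X (x t.+1 om)) <=
    r * Ex (fun om => quad X (x t om)) + C * Ex (fun om => sqnorm (B *m l + w t om)).
  rewrite -!ExZ // -ExD; [|exact: L1Z|exact: L1Z].
  apply: Ex_le => // [|om]; first by apply: L1D; exact: L1Z.
  by rewrite feedback_closed_loop.
have kE : C * Ex (fun om => sqnorm (B *m l + w t om)) = (1 - r) * k.
  by rewrite Ex_sqnorm_noise /k [RHS]mulrC divfK // gt_eqF.
rewrite kE in h; apply: (le_trans h).
have := ler_wpM2l r0 IH; have : r * quad X x0 <= quad X x0 by rewrite ler_piMl // ltW.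
lra.
Qed.

Lemma feedback_quadlin_bounded M b :
  exists K, forall t, `|Ex (fun om => quadlin M b (x t om))| <= K.
Proof.
have [K K0 Kx] := feedback_bounded; have [D D0 VD] := quadlin_le M b.
exists (D * (1 + K)) => t; have L : vL2 Pr (x t) by have [] := usq t.
have LV := L1_quadlin M b L; have Ls := L1_sqnorm L.
have Ld : L1 Pr (fun om => D * (1 + sqnorm (x t om))).
  by apply: L1Z; apply: L1D => //; exact: L1_cst.
have ub : Ex (fun om => D * (1 + sqnorm (x t om))) <= D * (1 + K).
  rewrite ExZ; last by apply: L1D => //; exact: L1_cst.
  by rewrite ler_wpM2l // ExD ?Ex_cst ?lerD2l //; exact: L1_cst.
rewrite ler_norml; apply/andP; split.
  rewrite lerNl (le_trans _ ub) // -ExN //.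
  apply: Ex_le => // [|om]; first exact: L1N.
  by have := VD (x t om); rewrite ler_norml lerNl => /andP[].
rewrite (le_trans _ ub) //; apply: Ex_le => // om.
exact: le_trans (ler_norm _) (VD _).
Qed.

(** Solving [Y = F^T Y F + M] turns the running cost into the decrement of a
    quadratic function of the state plus a constant, so its sum telescopes. *)
Lemma feedback_average M b k : exists l' : R,
  time_average (fun t => Ex (fun om => quadlin M b (x t om) + k)) @ \oo --> l'.
Proof.
have L t : vL2 Pr (x t) by have [] := usq t.
pose f := B *m l + wbar.
have [Y YE] := lyapunov_equation lyap M.
have [h hE] := lyapunov_affine_equation lyap (b + F^T *m ((Y + Y^T) *m f)).
have VE z : quadlin Y h (F *m z + f) = quadlin Y h z - quadlin M b z + quadlin Y h f.
  have eY : quad Y z = quad Y (F *m z) + quad M z.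
    rewrite [LHS](congr1 (fun N => quad N z) YE) [LHS]quad_bil bilMD.
    by rewrite -!quad_bil -quad_mul.
  have eh : dot h z = dot h (F *m z) + (dot b z +
      (bil Y (F *m z) f + bil Y f (F *m z))).
    rewrite [LHS](congr1 (fun v => dot v z) hE) dotC dotDr dot_trmul dotC.
    congr (_ + _); rewrite dotDr dotC dot_trmul; congr (_ + _).
    by rewrite -bil_dot bilMD [bil Y f _]bil_tr.
  rewrite /quadlin eY eh !quad_bil bilDl !bilDr dotDr; ring.
have [K EV] := feedback_quadlin_bounded Y h.
exists (quadlin Y h f + trW Y + k).
apply: (@time_average_cvg _ _ _ (fun T => Ex (fun om => quadlin Y h (x 0%N om))
   - Ex (fun om => quadlin Y h (x T om))) (K + K)).
  elim=> [|T IH]; first by rewrite big_ord0 mul0r subrr addr0.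
  rewrite big_ord_recr /= IH -natr1.
  have LV := L1_quadlin Y h (L T); have LM := L1_quadlin M b (L T).
  rewrite (Ex_quadlin_next usq).
  under [X in _ = _ + (_ - (Ex X + _))]eq_fun do rewrite feedback_drift VE.
  rewrite ExD //; last exact: L1_cst.
  rewrite [X in _ = _ + (_ - (X + _))]ExD; [|by apply: L1D => //; exact: L1N|exact: L1_cst].
  rewrite ExD //; last exact: L1N.
  rewrite ExN // !Ex_cst; lra.
by move=> T; rewrite (le_trans (ler_normB _ _)) // lerD.
Qed.

End stable_feedback.

Lemma measurable_quad p (M : 'M[R]_p) (y : Omega -> 'cV[R]_p) :
  measurable_fun setT y -> measurable_fun setT (fun om => quad M (y om)).
Proof.
move=> /measurable_mxP my; under eq_fun do rewrite quad_bil bilE.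
apply: measurable_sum => i; apply: measurable_sum => j.
by apply: measurable_funM => //; apply: measurable_funM.
Qed.

Lemma vL2_of_sqnorm p (y : Omega -> 'cV[R]_p) : measurable_fun setT y ->
  L1 Pr (fun om => sqnorm (y om)) -> vL2 Pr y.
Proof.
move=> /measurable_mxP my Ly i; apply: L2_of_sqr; first exact: my.
apply: (L1_bound _ Ly) => [|om]; first exact: measurable_funX.
by rewrite ger0_norm ?sqr_ge0 // sqr_entry_le.
Qed.

Lemma lqr_stage_cost_ge0 (x : 'cV[R]_n) (v : 'cV[R]_m) : 0 <= lqr_stage_cost Q Ru x v.
Proof.
have [_ Q0] := Qpsd; have [_ Rp] := Rpd; rewrite addr_ge0 //.
by have [->|/Rp/ltW//] := eqVneq v 0; rewrite quad0.
Qed.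

Lemma input_cost_le : exists2 C, 0 <= C & forall (x : 'cV[R]_n) (v : 'cV[R]_m),
  sqnorm v <= C * lqr_stage_cost Q Ru x v.
Proof.
have [C C0 CR] := pd_sqnorm_le Rpd; exists C => // x v.
have [_ Q0] := Qpsd.
by rewrite (le_trans (CR v)) // ler_wpM2l // lerDr.
Qed.

(** A finite average cost bounds every partial sum of nonnegative stage costs,
    so each control is square integrable and, by recursion, so is each state. *)
Lemma finite_cost_square_integrable u : is_policy A B x0 w xi u ->
  (average_cost Pr A B x0 (lqr_stage_cost Q Ru) w u < +oo)%E ->
  square_integrable_policy u.
Proof.
move=> pol fin; have ad := policy_adapted pol.
have mx t : measurable_fun setT (st u t) by exact: adapted_measurable (ad t).1.
have mu t : measurable_fun setT (u t) by exact: adapted_measurable (ad t).2.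
pose c t om := lqr_stage_cost Q Ru (st u t om) (u t om).
have c0 t om : 0 <= c t om by exact: lqr_stage_cost_ge0.
have mc t : measurable_fun setT (c t).
  by apply: measurable_funD; exact: measurable_quad.
have L1c t : L1 Pr (c t).
  have [N _ finN] := limn_esup_lt fin.
  pose T := (N + t).+1; have := finN T; rewrite /= => /(_ (leqW (leq_addr _ _))).
  set Sm := (fun om : Omega => _) => finT.
  have Sm0 om : 0 <= Sm om by apply: sumr_ge0 => i _; exact: c0.
  have mS : measurable_fun setT Sm by apply: measurable_sum => i; exact: mc.
  have LS : L1 Pr Sm.
    apply/Lfun1_integrable/integrableP; split; first exact/measurable_EFinP.
    rewrite (_ : (fun om => _) = EFin \o Sm); last first.
      by apply/funext => om /=; rewrite ger0_norm.
    have : ('E_Pr[Sm] < +oo)%E.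
      rewrite ltey; apply: contraTneq finT => ->.
      by rewrite gt0_muley ?ltxx // lte_fin invr_gt0 ltr0n.
    by rewrite unlock.
  apply: (L1_bound (mc t) LS) => om; rewrite ger0_norm //.
  have tT : (t < T)%N by rewrite ltnS leq_addl.
  by rewrite /Sm (bigD1 (Ordinal tT)) //= lerDl sumr_ge0 // => i _; exact: c0.
have [C C0 Cc] := input_cost_le.
have Lu t : vL2 Pr (u t).
  apply: vL2_of_sqnorm => //; apply: (L1_bound _ (L1Z C (L1c t))) => [|om].
    under eq_fun do rewrite sqnorm_quad; exact: measurable_quad.
  by rewrite ger0_norm ?sqnorm_ge0 //; exact: Cc.
have Lx t : vL2 Pr (st u t).
  elim: t => [|t IH]; first exact: vL2_cst.
  by apply: vL2D => //; apply: vL2D; exact: vL2_mulmx.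
by move=> t; have [ax au] := ad t.
Qed.

Section lower_bound.
Variables (Qhalf : 'M[R]_n).
Hypotheses (Qhalf_psd : psdmx Qhalf) (QhalfE : Qhalf *m Qhalf = Q).
Hypothesis (AQobs : observable A Qhalf).
Variable u : nat -> Omega -> 'cV[R]_m.
Hypothesis usq : square_integrable_policy u.

Let cost t := Ex (fun om => lqr_stage_cost Q Ru (st u t om) (u t om)).

(** A cost only sees the output [Qhalf x]; observability recovers the whole
    state from the costs of the next [n] steps. *)
Lemma second_moment_le : exists k c, [/\ 0 <= k, 0 <= c & forall t,
  Ex (fun om => sqnorm (st u t om)) <= c * \sum_(i < n) (k * cost (t + i)%N + 1)].
Proof.
have [c c0 obs] := observed_state Qhalf_psd QhalfE AQobs.
have [b b0 Bb] := sqnorm_mulmx_le B.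
have [r r0 Rr] := input_cost_le.
pose kappa := 2 * (sqnorm wbar + trW 1%:M) + 1.
have noiseE t : Ex (fun om => sqnorm (w t om)) = sqnorm wbar + trW 1%:M.
  rewrite -[wbar]add0r -(Ex_sqnorm_noise 0 t); congr Ex; apply/funext => om.
  by rewrite add0r.
have kappa1 : 1 <= kappa.
  rewrite lerDr mulr_ge0 // -(noiseE 0%N).
  by apply: Ex_ge0 => om; exact: sqnorm_ge0.
have kappa0 : 0 < kappa by exact: lt_le_trans kappa1.
pose k := (1 + 2 * (b * r)).
have k0 : 0 <= k by rewrite addr_ge0 // !mulr_ge0.
exists (k / kappa), (c * kappa); split; rewrite ?divr_ge0 ?mulr_ge0 ?(ltW kappa0) //.
move=> t.
have Lc s := L1_lqr_cost usq s.
have Ls s := L1_sqnorm (w_L2 s).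
have Lsum i : L1 Pr (fun om => k * lqr_stage_cost Q Ru (st u i om) (u i om)
    + 2 * sqnorm (w i om)) by apply: L1D; exact: L1Z.
have Lx : vL2 Pr (st u t) by have [] := usq t.
apply: (@le_trans _ _ (Ex (fun om => c * \sum_(i < n)
   (k * lqr_stage_cost Q Ru (st u (t + i) om) (u (t + i)%N om)
    + 2 * sqnorm (w (t + i)%N om))))).
  apply: Ex_le; [exact: L1_sqnorm|by apply: L1Z; exact: L1_sum|move=> om].
  have := obs (fun s => st u s om) (fun s => B *m u s om + w s om) _ t.
  move=> h; rewrite (le_trans (h _)) => [//|s|]; first by rewrite /= addrA.
  rewrite ler_wpM2l // ler_sum // => i _; set s := (t + i)%N.
  have h1 := sqnormD_le (B *m u s om) (w s om).
  have h2 := Bb (u s om); have h3 := ler_wpM2l b0 (Rr (st u s om) (u s om)).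
  have h4 : quad Q (st u s om) <= lqr_stage_cost Q Ru (st u s om) (u s om).
    have [_ Rp] := Rpd; rewrite lerDl.
    by have [->|/Rp/ltW//] := eqVneq (u s om) 0; rewrite quad0.
  rewrite /k; lra.
rewrite ExZ; last exact: L1_sum.
rewrite -mulrA ler_wpM2l // Ex_sum // mulr_sumr ler_sum // => i _.
rewrite ExD; [|exact: L1Z|exact: L1Z].
rewrite !ExZ // noiseE [leRHS](_ : _ = k * cost (t + i)%N + kappa).
  by rewrite lerD2l /kappa lerDl.
by rewrite mulrDr mulr1 mulrA mulrCA divff ?gt_eqF // mulr1.
Qed.

Lemma cost_ge0 t : 0 <= cost t.
Proof. by apply: Ex_ge0 => om; exact: lqr_stage_cost_ge0. Qed.

Lemma second_moment_frequently_sublinear a e N : 0 < e ->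
  (\forall T \near \oo, time_average cost T < a) ->
  exists2 T, (N <= T)%N & Ex (fun om => sqnorm (st u T om)) <= e * T%:R.
Proof.
move=> e0 costa; have [k [c [k0 c0 sm]]] := second_moment_le.
pose M := c * (n%:R * (k * (a * n.+1%:R) + 1)).
apply: (@frequently_sublinear _ (fun t => Ex (fun om => sqnorm (st u t om))) M) => //.
  by move=> t; apply: Ex_ge0 => om; exact: sqnorm_ge0.
case: costa => N1 _ costa; exists N1.+1 => // T /= N1T.
have suma T' : (N1.+1 <= T')%N -> \sum_(t < T') cost t <= a * T'%:R.
  move=> N1T'; have := costa _ (ltnW N1T'); rewrite /= /time_average => /ltW.
  by rewrite mulrC ler_pdivrMr // ltr0n (leq_trans _ N1T').
have a0 : 0 <= a.
  apply: le_trans (ltW (costa N1 (leqnn _))).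
  exact: time_average_ge0 cost_ge0.
apply: (@le_trans _ _ (c * \sum_(i < n) \sum_(t < T) (k * cost (t + i)%N + 1))).
  rewrite exchange_big /= mulr_sumr ler_sum // => t _; exact: sm.
rewrite /M -mulrA ler_wpM2l // -mulrA.
rewrite -[X in _ <= X%:R * _]card_ord mulr_natl -sumr_const ler_sum // => i _.
rewrite big_split /= -mulr_sumr sumr_const card_ord.
have h1 : \sum_(t < T) cost (t + i)%N <= a * (T + n)%:R.
  apply: le_trans (suma _ _); last by rewrite (leq_trans N1T) // leq_addr.
  by apply: sum_shift_le => //; [exact: cost_ge0|exact: ltnW].
have h2 : (T + n)%:R <= n.+1%:R * T.+1%:R :> R.
  by rewrite -natrM ler_nat mulSn mulnS addSn leqW // leq_add2l leq_addr.
rewrite mulrDl mul1r lerD //; last by rewrite ler_nat.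
rewrite -!mulrA ler_wpM2l // (le_trans h1) // ler_wpM2l //.
Qed.

Variables (lam : R) (P : 'M[R]_n) (g : 'cV[R]_n).
Hypotheses (lam0 : 0 <= lam) (Ppsd : psdmx P) (ricP : riccati A B Q Ru W lam P).
Hypothesis (ling : linear_term A B Q Ru wbar M3 lam P g).

(** Weak duality.  The terminal value of the telescoped Bellman identity is
    negligible against the horizon only along a subsequence, which suffices as
    the costs are upper limits. *)
Lemma dual_value_le a b :
  (average_cost Pr A B x0 (lqr_stage_cost Q Ru) w u < a%:E)%E ->
  (average_cost Pr A B x0 (risk_stage_cost Q W M3) w u < b%:E)%E ->
  dual_value P g <= a + lam * b.
Proof.
move=> /(average_cost_lt (L1_lqr_cost usq)) Ja.
move=> /(average_cost_lt (L1_risk_cost usq)) Jb.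
rewrite leNgt; apply/negP => gap.
pose dl := dual_value P g - (a + lam * b); have dl0 : 0 < dl by rewrite subr_gt0.
have [D D0 VD] := quadlin_le P g.
pose V t := Ex (fun om => quadlin P g (st u t om)).
(* small enough that the terminal value uses up half of the gap [dl] *)
pose e := dl / (2 * (D + 1)).
have D1 : 0 < D + 1 by rewrite ltr_wpDl.
have e0 : 0 < e by rewrite divr_gt0 // mulr_gt0.
have [N1 _ JaN] := Ja; have [N2 _ JbN] := Jb.
have [N3 N3P] : exists T : nat, 2 * (D + `|V 0%N|) / dl < T%:R.
  by exists (Num.truncn (2 * (D + `|V 0%N|) / dl)).+1; rewrite truncnS_gt.
have [T NT sT] := second_moment_frequently_sublinear (N1 + N2 + N3) e0 Ja.
have T0 : (0 : R) < T%:R.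
  apply: le_lt_trans (lt_le_trans N3P _); last first.
    by rewrite ler_nat (leq_trans _ NT) // leq_addl.
  by rewrite !mulr_ge0 ?invr_ge0 ?(ltW dl0) // addr_ge0.
have Lx : vL2 Pr (st u T) by have [] := usq T.
have VT : V T <= D * (1 + e * T%:R).
  apply: (@le_trans _ _ (Ex (fun om => D * (1 + sqnorm (st u T om))))).
    apply: Ex_le; [exact: L1_quadlin| |move=> om; exact: le_trans (ler_norm _) (VD _)].
    by apply: L1Z; apply: L1D; [exact: L1_cst|exact: L1_sqnorm].
  rewrite ExZ; last by apply: L1D; [exact: L1_cst|exact: L1_sqnorm].
  by rewrite ler_wpM2l // ExD ?Ex_cst ?lerD2l //; [exact: L1_cst|exact: L1_sqnorm].
have jT : \sum_(t < T) cost t <= a * T%:R.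
  have := JaN T; rewrite /= /time_average => /(_ _)/ltW.
  rewrite mulrC ler_pdivrMr //; apply.
  by rewrite (leq_trans _ NT) // -addnA leq_addr.
pose risk t := Ex (fun om => risk_stage_cost Q W M3 (st u t om) (u t om)).
have cT : \sum_(t < T) risk t <= b * T%:R.
  have := JbN T; rewrite /= /time_average => /(_ _)/ltW.
  rewrite mulrC ler_pdivrMr //; apply.
  by rewrite (leq_trans _ NT) // addnAC leq_addl.
have := bellman_sum usq Ppsd ricP ling T.
have -> : \sum_(t < T) Ex (fun om =>
      lagrangian_cost Q Ru W M3 lam (st u t om) (u t om)) =
    \sum_(t < T) cost t + lam * \sum_(t < T) risk t.
  rewrite mulr_sumr -big_split; apply: eq_bigr => t _.
  rewrite /cost /risk -ExZ; last exact: L1_risk_cost.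
  by rewrite /= -ExD; [|exact: L1_lqr_cost|apply: L1Z; exact: L1_risk_cost].
have : 0 <= \sum_(t < T) regret u P g t.
  by apply: sumr_ge0 => t _; exact: regret_ge0.
rewrite -/(V 0%N) -/(V T).
have lcT : lam * \sum_(t < T) risk t <= lam * (b * T%:R) by rewrite ler_wpM2l.
have V0 : - V 0%N <= `|V 0%N| by rewrite -normrN ler_norm.
have De : D * (e * T%:R) <= dl * T%:R / 2.
  have -> : dl * T%:R / 2 = (D + 1) * (e * T%:R).
    by rewrite /e; field; rewrite gt_eqF.
  by rewrite ler_wpM2r ?lerDl // mulr_ge0 // ltW.
have TT : 2 * (D + `|V 0%N|) < dl * T%:R.
  rewrite [ltRHS]mulrC -ltr_pdivrMr // (lt_le_trans N3P) // ler_nat.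
  by rewrite (leq_trans _ NT) // leq_addl.
have dlE : T%:R * dual_value P g = dl * T%:R + a * T%:R + lam * (b * T%:R).
  by rewrite /dl; ring.
lra.
Qed.

End lower_bound.

Section multipliers.
Variables (Qhalf : 'M[R]_n) (P : R -> 'M[R]_n) (g : R -> 'cV[R]_n).
Hypotheses (Qhalf_psd : psdmx Qhalf) (QhalfE : Qhalf *m Qhalf = Q).
Hypothesis (AQobs : observable A Qhalf).
Hypotheses (P_psd : forall lam : R, 0 <= lam -> psdmx (P lam))
  (P_riccati : forall lam : R, 0 <= lam -> riccati A B Q Ru W lam (P lam))
  (g_eq : forall lam : R, 0 <= lam ->
     linear_term A B Q Ru wbar M3 lam (P lam) (g lam)).

Local Notation phi lam := (affine_law A B Ru wbar (P lam) (g lam)).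
Local Notation ulam lam := (feedback A B x0 w (phi lam)).
Local Notation F lam := (closed_loop A B Ru (P lam)).

Let usq lam := @feedback_square_integrable (P lam) (g lam).

Definition running_lqr lam t : R :=
  Ex (fun om => lqr_stage_cost Q Ru (st (ulam lam) t om) (ulam lam t om)).

Definition running_risk lam t : R :=
  Ex (fun om => risk_stage_cost Q W M3 (st (ulam lam) t om) (ulam lam t om)).

Lemma stable lam : 0 <= lam -> exists X r C, lyapunov (F lam) X r C.
Proof.
move=> lam0; apply: (closed_loop_lyapunov Qpsd Rpd Qhalf_psd QhalfE AQobs _ lam0) => //.
- exact: (noise_covariance_psd w_L2 WE).
- exact: P_psd.
- exact: P_riccati.
Qed.

Lemma running_lqr_cvg lam : 0 <= lam ->
  exists j : R, time_average (running_lqr lam) @ \oo --> j.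
Proof.
move=> lam0; have [X [r [C lyap]]] := stable lam0.
pose K := lqr_gain A B Ru (P lam); pose l := lqr_offset B Ru wbar (P lam) (g lam).
have [j jP] := feedback_average (g lam) lyap
  (Q + K^T *m Ru *m K) ((- 2) *: (K^T *m (Ru *m l))) (quad Ru l).
exists j; rewrite (_ : running_lqr lam = fun t => Ex (fun om => quadlin
  (Q + K^T *m Ru *m K) ((- 2) *: (K^T *m (Ru *m l))) (st (ulam lam) t om) + quad Ru l)) //.
apply/funext => t; congr Ex; apply/funext => om.
rewrite /feedback -state_feedback /lqr_stage_cost /quadlin /affine_law.
move: (st _ t om) => y; have [RT _] := Rpd.
rewrite (addrC (- _)) quadD // [quad (Q + _) y]quad_bil bilMD -!quad_bil -quad_mul.
rewrite dotZl dotC dot_trmul -bil_dot bilNr (bil_tr _ l) RT -/K -/l.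
have -> : quad Ru (- (K *m y)) = quad Ru (K *m y).
  by rewrite !quad_bil bilNl bilNr opprK.
ring.
Qed.

Lemma running_risk_cvg lam : 0 <= lam ->
  exists jc : R, time_average (running_risk lam) @ \oo --> jc.
Proof.
move=> lam0; have [X [r [C lyap]]] := stable lam0.
have [jc jcP] := feedback_average (g lam) lyap
  (4 *: (Q *m W *m Q)) (4 *: (Q *m M3)) 0.
exists jc; rewrite (_ : running_risk lam = fun t => Ex (fun om => quadlin
  (4 *: (Q *m W *m Q)) (4 *: (Q *m M3)) (st (ulam lam) t om) + 0)) //.
by apply/funext => t; congr Ex; apply/funext => om; rewrite risk_stage_costE addr0.
Qed.

Section values.
Variables (j jc : R -> R).
Hypotheses (jP : forall lam : R, 0 <= lam -> time_average (running_lqr lam) @ \oo --> j lam)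
  (jcP : forall lam : R, 0 <= lam -> time_average (running_risk lam) @ \oo --> jc lam).

Lemma lagrangian_average_cvg lam mu : 0 <= mu ->
  time_average (fun t => Ex (fun om =>
    lagrangian_cost Q Ru W M3 lam (st (ulam mu) t om) (ulam mu t om))) @ \oo -->
  j mu + lam * jc mu.
Proof.
move=> mu0.
rewrite (_ : (fun t => _) = fun t => running_lqr mu t + lam * running_risk mu t).
  rewrite (_ : time_average _ = fun T => time_average (running_lqr mu) T
    + lam * time_average (running_risk mu) T).
    by apply: cvgD; [exact: jP|apply: cvgMr; exact: jcP].
  by apply/funext => T; rewrite time_averageD time_averageZ.
apply/funext => t; rewrite /running_lqr /running_risk -ExZ; last exact: L1_risk_cost.
by rewrite -ExD; [|exact: L1_lqr_cost|apply: L1Z; exact: L1_risk_cost].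
Qed.

Local Notation reg lam mu := (regret (ulam mu) (P lam) (g lam)).

(** Under a stable feedback the value at time [T] is bounded, so the Bellman
    identity becomes an identity between limits of averages. *)
Lemma regret_cvg_dual lam mu : 0 <= lam -> 0 <= mu ->
  time_average (reg lam mu) @ \oo -->
  j mu + lam * jc mu - dual_value (P lam) (g lam).
Proof.
move=> lam0 mu0; have [X [r [C lyap]]] := stable mu0.
set L := fun t => Ex (fun om =>
    lagrangian_cost Q Ru W M3 lam (st (ulam mu) t om) (ulam mu t om)).
have [K VK] := feedback_quadlin_bounded (g mu) lyap (P lam) (g lam).
have Lr : time_average (fun t => L t + -1 * reg lam mu t) @ \oo --> dual_value (P lam) (g lam).
  apply: (@time_average_cvg _ _ _ (fun T =>
     Ex (fun om => quadlin (P lam) (g lam) (st (ulam mu) 0%N om))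
     - Ex (fun om => quadlin (P lam) (g lam) (st (ulam mu) T om))) (K + K)).
    move=> T; rewrite big_split -mulr_sumr /= /L.
    rewrite (bellman_sum (usq mu) (P_psd lam0) (P_riccati lam0) (g_eq lam0)).
    by rewrite mulN1r addrK.
  by move=> T; rewrite (le_trans (ler_normB _ _)) // lerD.
rewrite (_ : time_average (reg lam mu) = fun T => time_average L T
    - time_average (fun t => L t + -1 * reg lam mu t) T).
  by apply: cvgB => //; exact: lagrangian_average_cvg.
by apply/funext => T; rewrite time_averageD time_averageZ; ring.
Qed.

(** The law for [lam] has no regret with respect to itself. *)
Lemma dual_valueE lam : 0 <= lam -> dual_value (P lam) (g lam) = j lam + lam * jc lam.
Proof.
move=> lam0; have := regret_cvg_dual lam0 lam0.
have -> : reg lam lam = fun=> 0.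
  apply/funext => t; rewrite /regret /feedback; under [X in Ex X]eq_fun do
    rewrite -state_feedback subrr quad0.
  by rewrite Ex_cst.
have -> : time_average (fun=> 0 : R) = fun=> 0.
  by apply/funext => T; rewrite /time_average big1 // mulr0.
move=> h; apply/eqP; rewrite eq_sym -subr_eq0; apply/eqP.
by rewrite -(cvg_lim _ h) // lim_cst.
Qed.

(** The loss of the law for [mu] in the Lagrangian problem of [lam]. *)
Definition value_gap lam mu := j mu + lam * jc mu - (j lam + lam * jc lam).

Lemma regret_cvg lam mu : 0 <= lam -> 0 <= mu ->
  time_average (reg lam mu) @ \oo --> value_gap lam mu.
Proof. by move=> lam0 mu0; rewrite /value_gap -dual_valueE //; exact: regret_cvg_dual. Qed.

Lemma value_gap_ge0 lam mu : 0 <= lam -> 0 <= mu -> 0 <= value_gap lam mu.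
Proof.
move=> lam0 mu0; apply: (cvgr_to_ge (regret_cvg lam0 mu0)); apply: nearW => T.
by apply: time_average_ge0 => t; apply: regret_ge0; exact: P_psd.
Qed.

(** The gaps of [mu] at [lam] and of [lam] at [mu] add up to the right-hand
    side. *)
Lemma value_gap_le lam mu : 0 <= lam -> 0 <= mu ->
  value_gap lam mu <= (lam - mu) * (jc mu - jc lam).
Proof.
move=> lam0 mu0; have := value_gap_ge0 mu0 lam0; rewrite /value_gap; lra.
Qed.

(** Driving both closed loops with the same noise, their distance obeys the
    stable dynamics of the first one, forced by the deviation of the controls,
    which the regret measures. *)
Lemma coupling lam : 0 <= lam -> exists2 c, 0 <= c & forall mu T, 0 <= mu ->
  time_average (fun t => Ex (fun om => sqnorm (st (ulam mu) t om - st (ulam lam) t om))) T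
  <= c * time_average (reg lam mu) T.
Proof.
move=> lam0; have [X [r [C lyap]]] := stable lam0.
have [_ /andP[r0 r1] C0 _ _] := lyap.
have [b b0 Bb] := sqnorm_mulmx_le B.
have [h h0 Hh] := pd_sqnorm_le (lqr_hessian_pd B Rpd (P_psd lam0)).
have k0 : 0 <= C * C / (1 - r) by rewrite divr_ge0 ?mulr_ge0 // subr_ge0 ltW.
exists (C * C / (1 - r) * (b * h)); first by rewrite mulr_ge0 // mulr_ge0.
move=> mu T mu0; rewrite /time_average mulrCA ler_wpM2l ?invr_ge0 //.
have Lx nu t : vL2 Pr (st (ulam nu) t) by have [] := usq nu t.
have Le t : vL2 Pr (fun om => st (ulam mu) t om - st (ulam lam) t om).
  by apply: vL2D => //; exact: vL2N.
have Ld t : vL2 Pr (fun om => ulam mu t om - phi lam (st (ulam mu) t om)).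
  exact: (vL2_deviation (usq mu)).
have LH t := L1_quad (lqr_hessian B Ru (P lam)) (Ld t).
have Ls t := L1_sqnorm (Le t).
rewrite -!Ex_sum // -ExZ; last exact: L1_sum.
apply: Ex_le; [exact: L1_sum|by apply: L1Z; exact: L1_sum|move=> om].
pose e t := st (ulam mu) t om - st (ulam lam) t om.
pose v t := B *m (ulam mu t om - phi lam (st (ulam mu) t om)).
have ev t : e t.+1 = F lam *m e t + v t.
  have next : st (ulam mu) t.+1 om =
    A *m st (ulam mu) t om + B *m ulam mu t om + w t om by [].
  rewrite /e /v next [st (ulam lam) _ _]feedback_closed_loop.
  move: (ulam mu t om) (st (ulam mu) t om) (st (ulam lam) t om) => q y z.
  have FE x : F lam *m x = A *m x - B *m (lqr_gain A B Ru (P lam) *m x).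
    by rewrite mulmxBl [in RHS]mulmxA.
  rewrite /affine_law; move: (lqr_offset _ _ _ _ _) => l.
  rewrite !mulmxBr !FE mulmxDr mulmxN.
  move: (A *m y) (A *m z) (B *m q) (B *m l) (B *m (_ *m y)) (B *m (_ *m z)).
  by move=> a1 a2 b1 b2 b3 b4; apply/colP => i; rewrite !mxE; ring.
have e0 : e 0%N = 0 by rewrite /e /= subrr.
rewrite (le_trans (lyapunov_sum lyap T e0 ev)) // -[leRHS]mulrA ler_wpM2l //.
rewrite mulr_sumr ler_sum // => t _; rewrite (le_trans (Bb _)) // -[leRHS]mulrA ler_wpM2l //.
Qed.

(** Along the coupled trajectories the risks differ by [eps] and a multiple of
    the squared distance, whose average the regret bounds. *)
Lemma risk_value_le_gap lam eps : 0 <= lam -> 0 < eps -> exists2 c, 0 <= c &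
  forall mu, 0 <= mu -> `|jc mu - jc lam| <= eps + c * value_gap lam mu.
Proof.
move=> lam0 eps0; have [X [r [C lyap]]] := stable lam0.
have [K K0 Kx] := feedback_bounded (g lam) lyap.
have K1 : 0 < 1 + K by rewrite ltr_wpDr.
have [D D0 qD] := quadlin_perturb (4 *: (Q *m W *m Q)) (4 *: (Q *m M3))
  (divr_gt0 eps0 K1).
have [c c0 cP] := coupling lam0; exists (D * c); first exact: mulr_ge0.
move=> mu mu0.
have Lx nu t : vL2 Pr (st (ulam nu) t) by have [] := usq nu t.
have Le t : vL2 Pr (fun om => st (ulam mu) t om - st (ulam lam) t om).
  by apply: vL2D => //; exact: vL2N.
pose dist t := Ex (fun om => sqnorm (st (ulam mu) t om - st (ulam lam) t om)).
have Lsx t := L1_sqnorm (Lx lam t); have Lse t := L1_sqnorm (Le t).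
have L1x t : L1 Pr (fun om => 1 + sqnorm (st (ulam lam) t om)).
  by apply: L1D => //; exact: L1_cst.
have Ll t := L1Z (eps / (1 + K)) (L1x t); have Lr' t := L1Z D (Lse t).
have L1d t := L1D (Ll t) (Lr' t).
have Lr nu t := L1_risk_cost (usq nu) t.
have bound t : Ex (fun om => eps / (1 + K) * (1 + sqnorm (st (ulam lam) t om))
    + D * sqnorm (st (ulam mu) t om - st (ulam lam) t om)) <= eps + D * dist t.
  rewrite ExD // !ExZ // lerD2r ExD //; last exact: L1_cst.
  by rewrite Ex_cst mulrAC ler_pdivrMr // ler_wpM2l ?(ltW eps0) // lerD2l.
have pert om t : `|risk_stage_cost Q W M3 (st (ulam mu) t om) (ulam mu t om)
     - risk_stage_cost Q W M3 (st (ulam lam) t om) (ulam lam t om)| <=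
    eps / (1 + K) * (1 + sqnorm (st (ulam lam) t om))
    + D * sqnorm (st (ulam mu) t om - st (ulam lam) t om).
  rewrite !risk_stage_costE.
  have := qD (st (ulam lam) t om) (st (ulam mu) t om - st (ulam lam) t om).
  by rewrite subrKC.
have lim : (fun T => eps + D * c * time_average (reg lam mu) T) @ \oo -->
    eps + D * c * value_gap lam mu.
  by apply: cvgD; [exact: cvg_cst|apply: cvgMr; exact: regret_cvg].
have avg T (a : nat -> R) : (forall t, a t <= eps + D * dist t) ->
    time_average a T <= eps + D * c * time_average (reg lam mu) T.
  move=> ha; apply: (le_trans (time_average_le T ha)).
  rewrite time_averageD time_averageZ lerD //.
    by apply: time_average_le_cst => //; exact: ltW.
  by rewrite -mulrA ler_wpM2l // cP.
have diff (nu1 nu2 : R) : 0 <= nu1 -> 0 <= nu2 ->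
    time_average (fun t => running_risk nu1 t + -1 * running_risk nu2 t) @ \oo -->
    jc nu1 - jc nu2.
  move=> h1 h2; rewrite (_ : time_average _ = fun T =>
    time_average (running_risk nu1) T - time_average (running_risk nu2) T).
    by apply: cvgB; exact: jcP.
  by apply/funext => T; rewrite time_averageD time_averageZ mulN1r.
rewrite ler_norml lerNl opprB; apply/andP; split.
  apply: (le_cvg_near (diff lam mu lam0 mu0) lim) => T; apply: avg => t.
  apply: le_trans (bound t); rewrite /running_risk -ExZ // -ExD //; last exact: L1Z.
  apply: Ex_le => // [|om]; first by apply: L1D => //; exact: L1Z.
  by rewrite mulN1r (le_trans (ler_norm _)) // distrC; exact: pert.
apply: (le_cvg_near (diff mu lam mu0 lam0) lim) => T; apply: avg => t.
apply: le_trans (bound t); rewrite /running_risk -ExZ // -ExD //; last exact: L1Z.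
apply: Ex_le => // [|om]; first by apply: L1D => //; exact: L1Z.
by rewrite mulN1r (le_trans (ler_norm _)) //; exact: pert.
Qed.

(** Optimality of each feedback law for its own multiplier bounds the gap by
    [|lam - mu| |jc mu - jc lam|], so the previous estimate becomes continuity. *)
Lemma risk_value_continuous lam eps : 0 <= lam -> 0 < eps -> exists2 dl, 0 < dl &
  forall mu, 0 <= mu -> `|mu - lam| < dl -> `|jc mu - jc lam| <= eps.
Proof.
move=> lam0 eps0.
have e2 : 0 < eps / 2 by rewrite divr_gt0.
have [c c0 cP] := risk_value_le_gap lam0 e2.
have c1 : 0 < 2 * (c + 1) by rewrite mulr_gt0 // ltr_wpDl.
exists (2 * (c + 1))^-1; first by rewrite invr_gt0.
move=> mu mu0 close; have := cP mu mu0; have := value_gap_le lam0 mu0.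
set D := `|jc mu - jc lam|; set G := value_gap lam mu => GD h.
have D0 : 0 <= D by exact: normr_ge0.
have GD2 : G <= `|mu - lam| * D.
  by rewrite (le_trans GD) // (le_trans (ler_norm _)) // normrM distrC.
have close2 : `|mu - lam| * (2 * (c + 1)) <= 1.
  by rewrite -ler_pdivlMr // div1r ltW.
have h1 : c * G <= c * (`|mu - lam| * D) by rewrite ler_wpM2l.
have h2 : `|mu - lam| * (2 * (c + 1)) * D <= 1 * D by rewrite ler_wpM2r.
have h3 : 0 <= `|mu - lam| * D by rewrite mulr_ge0.
lra.
Qed.

End values.
End multipliers.

End controlled_system.

(** * The constrained problem *)

Theorem theorem2 (R : realType) (n m : nat)
  (* probability space, randomization seeds and noise *)
  (d : measure_display) (Omega : measurableType d) (Pr : probability Omega R)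
  (dS : measure_display) (S : measurableType dS)
  (xi : nat -> Omega -> S) (w : nat -> Omega -> 'cV[R]_n)
  (* plant and cost data *)
  (A : 'M[R]_n) (B : 'M[R]_(n, m)) (x0 : 'cV[R]_n)
  (Q Qhalf : 'M[R]_n) (Ru : 'M[R]_m)
  (wbar : 'cV[R]_n) (W : 'M[R]_n) (M3 : 'cV[R]_n) (m4 rho : R)
  (P : R -> 'M[R]_n) (g : R -> 'cV[R]_n)
  (* standing assumptions *)
  (Qpsd : psdmx Q) (Rpd : pdmx Ru) (ABstab : stabilizable A B)
  (Qhalf_psd : psdmx Qhalf) (QhalfE : Qhalf *m Qhalf = Q)
  (AQobs : observable A Qhalf)
  (* noise *)
  (xi_meas : forall t, measurable_fun setT (xi t))
  (w_meas : forall t, measurable_fun setT (w t))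
  (w_moment4 : forall t (i : 'I_n), (fun om => w t om i 0) \in Lfun Pr 4%:E)
  (w_uncorr : uncorrelated_noise Pr w xi)
  (wbarE : forall t, wbar = mx_expectation Pr (w t))
  (WE : forall t, W =
     mx_expectation Pr (fun om => (w t om - wbar) *m (w t om - wbar)^T))
  (M3E : forall t, M3 = mx_expectation Pr
     (fun om => (w t om - wbar) *m (w t om - wbar)^T *m Q *m (w t om - wbar)))
  (m4E : forall t, m4%:E =
     'E_Pr[(fun om => (quad Q (w t om - wbar) - \tr (W *m Q)) ^+ 2)%R]%E)
  (* risk tolerance *)
  (rho_gt0 : 0 < rho)
  (* P and g are the solutions of the Riccati and the linear equation *)
  (P_psd : forall lam, 0 <= lam -> psdmx (P lam))
  (P_riccati : forall lam, 0 <= lam -> riccati A B Q Ru W lam (P lam))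
  (g_eq : forall lam, 0 <= lam ->
     linear_term A B Q Ru wbar M3 lam (P lam) (g lam)) :
  let rhobar := rho - m4 + 4 * \tr ((W *m Q) ^+ 2) in
  let policy := is_policy A B x0 w xi in
  let J := average_cost Pr A B x0 (lqr_stage_cost Q Ru) w in
  let Jc := average_cost Pr A B x0 (risk_stage_cost Q W M3) w in
  let u_ lam :=
    feedback A B x0 w (affine_law A B Ru wbar (P lam) (g lam)) in
  let lamstar :=
    inf [set lam : R | 0 <= lam /\ (Jc (u_ lam) <= rhobar%:E)%E] in
  (exists v, [/\ policy v, (J v < +oo)%E & (Jc v < rhobar%:E)%E]) ->
  constrained_optimal policy J Jc rhobar (u_ lamstar).

Proof.
move=> rhobar policy J Jc u_ lamstar [v [pol_v Jv Jcv]].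
have w_L2 t : vL2 Pr (w t).
  move=> i; apply: (@Lfun_subset _ _ _ Pr 2%:E 4%:E) (w_moment4 t i).
  - by rewrite lee_fin ler1n.
  - by rewrite lee_fin ler1n.
  - exact: fin_num_measure.
  - by rewrite lee_fin ler_nat.
have usq lam := @feedback_square_integrable _ _ _ _ _ Pr _ _ xi w A B x0 Ru wbar
  w_L2 (P lam) (g lam).
have /choice[j jE] : forall lam, exists l : R, 0 <= lam ->
    time_average (running_lqr Pr w A B x0 Q Ru wbar P g lam) @ \oo --> l.
  move=> lam; have [lam0|_] := lerP 0 lam; last by exists 0.
  have [l lP] := running_lqr_cvg x0 w_L2 w_uncorr wbarE WE Qpsd Rpd g Qhalf_psd
    QhalfE AQobs P_psd P_riccati lam0.
  by exists l.
have /choice[jc jcE] : forall lam, exists l : R, 0 <= lam ->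
    time_average (running_risk Pr w A B x0 Q Ru wbar W M3 P g lam) @ \oo --> l.
  move=> lam; have [lam0|_] := lerP 0 lam; last by exists 0.
  have [l lP] := running_risk_cvg x0 M3 w_L2 w_uncorr wbarE WE Qpsd Rpd g Qhalf_psd
    QhalfE AQobs P_psd P_riccati lam0.
  by exists l.
have JE lam : 0 <= lam -> J (u_ lam) = (j lam)%:E.
  by move=> lam0; apply: (average_cost_cvg (L1_lqr_cost Q Ru (usq lam)) (jE _ lam0)).
have JcE lam : 0 <= lam -> Jc (u_ lam) = (jc lam)%:E.
  by move=> lam0; apply: (average_cost_cvg (L1_risk_cost Q W M3 (usq lam)) (jcE _ lam0)).
have dual lam u a b : policy u -> 0 <= lam -> (J u < +oo)%E ->
    (J u < a%:E)%E -> (Jc u < b%:E)%E -> j lam + lam * jc lam <= a + lam * b.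
  move=> pu lam0 Ju Jua Jcb.
  have sq := finite_cost_square_integrable xi_meas w_meas w_L2 Qpsd Rpd pu Ju.
  rewrite -(dual_valueE w_L2 w_uncorr wbarE WE Qpsd Rpd Qhalf_psd QhalfE AQobs
    P_psd P_riccati g_eq jE jcE lam0).
  exact: (dual_value_le w_L2 w_uncorr wbarE WE Qpsd Rpd Qhalf_psd QhalfE AQobs
    sq lam0 (P_psd _ lam0) (P_riccati _ lam0) (g_eq _ lam0) Jua Jcb).
have cont := risk_value_continuous w_L2 w_uncorr wbarE WE Qpsd Rpd Qhalf_psd
  QhalfE AQobs P_psd P_riccati g_eq jE jcE.
have j_ge0 lam : 0 <= lam -> 0 <= j lam.
  move=> lam0; apply: (cvgr_to_ge (jE _ lam0)); apply: nearW => T.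
  apply: time_average_ge0 => t; apply: Ex_ge0 => om.
  exact: lqr_stage_cost_ge0.
pose Lam := [set lam : R | 0 <= lam /\ (Jc (u_ lam) <= rhobar%:E)%E].
have LamP lam : Lam lam -> 0 <= lam /\ jc lam <= rhobar.
  by move=> [lam0]; rewrite JcE // lee_fin.
have Lam_ne : Lam !=set0.
  (* weak duality against the Slater policy: the cost being nonnegative, a large
     multiplier forces the risk below [rhobar] *)
  have [b Jcvb brho] : exists2 b, (Jc v < b%:E)%E & b < rhobar.
    case: (Jc v) Jcv => [r| |] //.
      rewrite lte_fin => rr; exists ((r + rhobar) / 2); rewrite ?lte_fin; lra.
    by move=> _; exists (rhobar - 1); [exact: ltNyr|lra].
  have [a Jva a0] : exists2 a, (J v < a%:E)%E & 0 < a.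
    case: (J v) Jv => [r| |] // _; last by exists 1; [exact: ltNyr|].
    exists (`|r| + 1); last by rewrite ltr_wpDl.
    by rewrite lte_fin (le_lt_trans (ler_norm _)) // ltrDl.
  have lam0 : 0 < a / (rhobar - b) by rewrite divr_gt0 // subr_gt0.
  exists (a / (rhobar - b)); split; first exact: ltW.
  rewrite (JcE _ (ltW lam0)) lee_fin.
  have := dual _ _ _ _ pol_v (ltW lam0) Jv Jva Jcvb.
  have aE : a = a / (rhobar - b) * (rhobar - b).
    by rewrite divfK // gt_eqF // subr_gt0.
  set lam := a / (rhobar - b) in lam0 aE *; have := j_ge0 _ (ltW lam0) => j0 h.
  rewrite -(ler_pM2l lam0); rewrite {1}aE in h; lra.
have Lam_lb : lbound Lam 0 by move=> lam /LamP[].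
have Lam_inf : has_inf Lam by split=> //; exists 0.
have ls0 : 0 <= lamstar by exact: lb_le_inf.
(* multipliers in [Lam] come arbitrarily close to their infimum *)
have jc_le : jc lamstar <= rhobar.
  apply/ler_addgt0Pr => e e0; have [dl dl0 near] := cont _ _ ls0 e0.
  have [lam /[dup] lamL /LamP[lam0 jlam] lamlt] := inf_adherent dl0 Lam_inf.
  have ge : lamstar <= lam by exact: (ge_inf Lam_inf.2 lamL).
  have := near lam lam0 _; rewrite ger0_norm ?subr_ge0 // ltrBlDl => /(_ lamlt).
  by rewrite ler_norml => /andP[h _]; lra.
(* complementary slackness, as no multiplier below [lamstar] is in [Lam] *)
have slack : 0 < lamstar -> rhobar <= jc lamstar.
  move=> lsp; apply/ler_addgt0Pr => e e0; have [dl dl0 near] := cont _ _ ls0 e0.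
  pose mu := Num.max 0 (lamstar - dl / 2).
  have mu0 : 0 <= mu by rewrite le_max lexx.
  have mult : mu < lamstar by rewrite gt_max lsp /= ltrBlDr ltrDl divr_gt0.
  have mudl : `|mu - lamstar| < dl.
    rewrite distrC ger0_norm ?subr_ge0 ?ltW // ltrBlDl -ltrBlDr lt_max.
    by apply/orP; right; lra.
  have jmu : rhobar < jc mu.
    rewrite ltNge; apply/negP => h.
    have muL : Lam mu by split => //; rewrite JcE // lee_fin.
    by have := ge_inf Lam_inf.2 muL; rewrite leNgt mult.
  by have := near mu mu0 mudl; rewrite ler_norml => /andP[_ h]; lra.
split.
- exact: affine_law_policy.
- by rewrite JcE // lee_fin.
move=> u pol_u Jcu; rewrite JE //.
rewrite leNgt; apply/negP => Ju.
have [a Jua alt] : exists2 a, (J u < a%:E)%E & a < j lamstar.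
  case: (J u) Ju => [r| |] //.
    by rewrite lte_fin => h; exists ((r + j lamstar) / 2); rewrite ?lte_fin; lra.
  by move=> _; exists (j lamstar - 1); [exact: ltNyr|lra].
(* the slack [e] in the risk is small enough that its price [lamstar * e] does
   not make up for the difference between [a] and [j lamstar] *)
pose e := (j lamstar - a) / (2 * (lamstar + 1)).
have l1 : 0 < lamstar + 1 by rewrite ltr_wpDl.
have e0 : 0 < e by rewrite divr_gt0 ?mulr_gt0 // subr_gt0.
have Jub : (Jc u < (rhobar + e)%:E)%E.
  by rewrite (le_lt_trans Jcu) // lte_fin ltrDl.
have := dual _ _ _ _ pol_u ls0 (lt_trans Jua (ltry _)) Jua Jub.
have slackM : lamstar * rhobar <= lamstar * jc lamstar.
  have [ls|ls] := leP lamstar 0; last by rewrite ler_pM2l // slack.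
  have -> : lamstar = 0 by apply/eqP; rewrite eq_le ls ls0.
  by rewrite !mul0r.
have eE : (lamstar + 1) * e = (j lamstar - a) / 2.
  by rewrite /e; field; rewrite gt_eqF.
lra.
Qed.
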